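(* Let $X$ be a separable real Banach space, let $Y$ be a real Banach space with the Radon–Nikodým property, let $G\subset X$ be open and let $f:G\to Y$ be a Lipschitz function. Then $f$ is Gâteaux differentiable outside a $\Gamma$-null set; that is, the set of points of $G$ at which $f$ is not Gâteaux differentiable is a $\Gamma$-null subset of $X$.
   Context: A Banach space $Y$ has the Radon–Nikodým property (RNP) if every Lipschitz function $\mathbb{R}\to Y$ is differentiable almost everywhere. $f$ is Gâteaux differentiable at $x$ if there is a bounded linear operator $D_f(x):X\to Y$ with $\lim_{t\to0}(f(x+tu)-f(x))/t=D_f(x)u$ for every $u\in X$. $\Gamma$-null sets. $T=[0,1]^{\mathbb{N}}$ carries the product topology and the product Lebesgue (probability) measure $\mu$. $\Gamma(X)$ is the space of continuous maps $\gamma:T\to X$ having continuous partial derivatives $D_j\gamma:T\to X$ for all $j\in\mathbb{N}$ (one-sided where the $j$-th coordinate is $0$ or $1$), with the topology generated by the seminorms $\|\gamma\|_0=\sup_{t\in T}\|\gamma(t)\|$ and $\|\gamma\|_k=\sup_{t\in T}\|D_k\gamma(t)\|$, $k\ge1$. A Borel set $N\subset X$ is $\Gamma$-null if $\mu\{t\in T:\gamma(t)\in N\}=0$ for all $\gamma$ in a residual (comeager) subset of $\Gamma(X)$. An arbitrary set is $\Gamma$-null if it is contained in a Borel $\Gamma$-null set. *)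

(* Defs.v *)
From HB Require Import structures.
From mathcomp Require Import all_boot all_order all_algebra.
From mathcomp Require Import all_classical all_reals all_analysis.
From mathcomp Require Import borel_hierarchy.

Set Implicit Arguments.
Unset Strict Implicit.
Unset Printing Implicit Defensive.

Import Order.TTheory GRing.Theory Num.Theory.
Import numFieldNormedType.Exports.

Local Open Scope classical_set_scope.
Local Open Scope ring_scope.

Definition separable_space (T : topologicalType) : Prop :=
  exists2 D : set T, countable D & dense D.

Definition Radon_Nikodym_property (R : realType)
    (Y : completeNormedModType R) : Prop :=
  forall g : R -> Y, lipschitz g ->
    {ae (@lebesgue_measure R), forall t, derivable g t 1}.

Definition Gateaux_differentiable (R : realType)
    (X Y : completeNormedModType R) (f : X -> Y) (x : X) : Prop :=
  exists D : {linear X -> Y}, continuous D /\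
    forall u : X, t^-1 *: (f (x + t *: u) - f x) @[t --> 0^'] --> D u.

Definition borel (T : ptopologicalType) : measurableType _ :=
  g_sigma_algebraType (@open T).

Definition unit_interval (R : realType) : Type := set_type (`[0%R : R, 1%R]%classic).

HB.instance Definition _ (R : realType) := PseudoMetric.copy (unit_interval R)
  (set_type (`[0%R : R, 1%R]%classic)).

Lemma unit_interval0 (R : realType) : (0 : R) \in `[0%R : R, 1%R]%classic.
Proof. by rewrite inE /= in_itv /= lexx ler01. Qed.

HB.instance Definition _ (R : realType) :=
  isPointed.Build (unit_interval R) (exist _ 0 (unit_interval0 R)).

Definition cube (R : realType) : Type :=
  prod_topology (fun _ : nat => unit_interval R).

HB.instance Definition _ (R : realType) := PseudoMetric.copy (cube R)
  (prod_topology (fun _ : nat => unit_interval R)).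
HB.instance Definition _ (R : realType) :=
  isPointed.Build (cube R) (fun _ => point).

(* The product of the Lebesgue measures on the factors [0,1]; the values on
   finite-dimensional boxes determine such a probability measure. *)
Definition product_lebesgue (R : realType)
    (mu : probability (borel (cube R)) R) : Prop :=
  forall (n : nat) (B : nat -> set R),
    (forall i, (i < n)%N -> measurable (B i)) ->
    mu [set t : cube R | forall i, (i < n)%N -> B i (\val (t i))] =
    (\prod_(i < n) fine (@lebesgue_measure R (B i `&` `[0, 1])))%:E.

Section Gamma.
Variables (R : realType) (X : completeNormedModType R).

(* [s --> (t j)^'] ranges over the deleted neighbourhoods of [t j] in [0,1],
   hence it is a one-sided limit when [t j] is 0 or 1. *)
Definition partial_derivable (h : cube R -> X) (j : nat) (t : cube R) : Prop :=
  cvg ((\val s - \val (t j))^-1 *: (h (dfwith t j s) - h t) @[s --> (t j)^']).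

Definition partial_derive (j : nat) (h : cube R -> X) (t : cube R) : X :=
  lim ((\val s - \val (t j))^-1 *: (h (dfwith t j s) - h t) @[s --> (t j)^']).

Definition Gamma_set : set (cube R -> X) :=
  [set h | continuous h /\
    forall j, (forall t, partial_derivable h j t) /\
              continuous (partial_derive j h)].

Definition Gamma : Type := {h : cube R -> X | h \in Gamma_set}.
HB.instance Definition _ := Choice.on Gamma.

Definition Gamma_fun (g : Gamma) : cube R -> X := \val g.
Coercion Gamma_fun : Gamma >-> Funclass.

(* Coordinates are numbered from 0, so [Gamma_seminorm j.+1] is the seminorm
   attached to the derivative along the coordinate [j]. *)
Definition Gamma_seminorm (k : nat) (h : cube R -> X) : R :=
  sup (range (fun t => `|if k is j.+1 then partial_derive j h t else h t|)).

Definition Gamma_ball (k : nat) (g : Gamma) (e : R) : set Gamma :=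
  [set g' : Gamma | Gamma_seminorm k (fun t => g' t - g t) < e].

HB.instance Definition _ := isSubBaseTopological.Build Gamma
  [set B | exists k g e, 0 < e /\ B = Gamma_ball k g e] id.

End Gamma.

Definition residual (T : topologicalType) (S : set T) : Prop :=
  exists2 A, Gdelta_dense A & A `<=` S.

Definition Borel_Gamma_null (R : realType)
    (mu : probability (borel (cube R)) R)
    (X : completeNormedModType R) (N : set X) : Prop :=
  measurable (N : set (borel X)) /\
  residual [set g : Gamma X | mu [set t | N (g t)] = 0%E].

Definition Gamma_null (R : realType) (mu : probability (borel (cube R)) R)
    (X : completeNormedModType R) (A : set X) : Prop :=
  exists2 N : set X, Borel_Gamma_null mu N & A `<=` N.

(* Main.v *)
Require Import Defs.
From HB Require Import structures.
From mathcomp Require Import all_boot all_order all_algebra.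
From mathcomp Require Import all_classical all_reals all_analysis.
From mathcomp Require Import measurable_realfun lra.

Set Implicit Arguments.
Unset Strict Implicit.
Unset Printing Implicit Defensive.

Import Order.TTheory GRing.Theory Num.Theory.
Import numFieldNormedType.Exports.

Local Open Scope classical_set_scope.
Local Open Scope ring_scope.

(* Call a surface [g] steep in direction [u] if, for some coordinate [n] and
   some [eta > 0], its partial derivative along [n] is uniformly within
   [eta * d] of [eta *: u]. Such surfaces form an open set by definition of the
   topology, and a dense one: freeze a far coordinate of a given surface, which
   changes finitely many seminorms only a little by compactness of the cube, and
   add [eta * t_n *: u]. If [h] is Lipschitz and [g] is steep, then along each
   line parallel to the [n]-th axis [h o g] is a Lipschitz curve, hence
   differentiable almost everywhere by the RNP of [Y], and there the difference
   quotients of [h] at [g t] in direction [u] oscillate by at most [O(d)]. By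
   Fubini and [d -> 0], the points at which the derivative of [h] in direction
   [u] does not exist form a Gamma-null set.

   This single fact also yields additivity of the directional derivatives. Let
   [A] be the set of points at which the difference quotients of [h] in direction
   [v], up to a fixed scale, are within [e] of a fixed [z]. If [x] is in [A] and
   the Lipschitz map [y |-> dist (y, A) *: y0], with [y0 != 0], has a derivative
   at [x] in direction [u], then [dist (x + t *: u, A) = o(t)], and comparing [h]
   at [x + t *: u] with [h] at a nearby point of [A] shows that
   [h'(x; u + v) - h'(x; u)] is within [e] of [z]. Countably many sets [A] and a
   dense sequence of directions suffice. A function that is Lipschitz on [G]
   only is cut off on countably many balls covering [G]. *)

(** * The cube *)

Section cube_topology.
Variable R : realType.

(** The product topology is a supremum of topologies pulled back along the coordinates, and that of
    [unit_interval R] is pulled back along [\val], so convergence is tested on real coordinates. *)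
Lemma cvg_cube (I : Type) (F : set_system I) (f : I -> cube R) (t : cube R) :
  Filter F ->
  (forall k, (\val (f i k)) @[i --> F] --> (\val (t k) : R)) ->
  f i @[i --> F] --> t.
Proof.
move=> FF ft; apply/cvg_sup => k A.
move=> [B [[C [D oD DC] CB] Bt] BA].
rewrite /= nbhs_simpl; apply: filterS BA _.
have Dt : nbhs (\val (t k) : R) D.
  by apply: open_nbhs_nbhs; split => //; move: Bt; rewrite -CB -DC.
have := ft k D Dt; rewrite nbhs_simpl.
by rewrite /nbhs /=; apply: filterS => i /=; rewrite -CB -DC.
Qed.

Lemma cube_coord_continuous k : continuous (fun t : cube R => \val (t k) : R).
Proof.
move=> t A; rewrite nbhsE => -[D [oD Dt] DA].
have /cvg_sup/(_ k) : nbhs t --> t by apply: cvg_id.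
move=> /(_ ((fun t : cube R => \val (t k) : R) @^-1` D)) tD.
rewrite /= nbhs_simpl; apply: filterS (tD _) => [x /DA //|].
rewrite nbhsE; exists ((fun t : cube R => \val (t k) : R) @^-1` D) => //; split => //.
exists (\val @^-1` D) => //; exists D => //.
Qed.

(** The retraction of the line onto [0,1]. It extends curves defined on the unit interval to all of
    [R], where the RNP and Lebesgue measure apply, and later it is the profile of the cut-off
    functions. *)
Definition clamp (x : R) : R := Num.max 0 (Num.min 1 x).

Lemma clampP x : clamp x \in `[0%R : R, 1%R]%classic.
Proof.
rewrite inE /= in_itv /= /clamp le_max lexx /= ge_max ler01 /=.
by rewrite ge_min lexx.
Qed.

Definition to_unit (x : R) : unit_interval R := exist _ (clamp x) (clampP x).

Lemma to_unitE x : 0 <= x <= 1 -> \val (to_unit x) = x.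
Proof. by move=> /andP[x0 x1] /=; rewrite /clamp min_r// max_r. Qed.

Lemma clamp_lip x y : `|clamp x - clamp y| <= `|x - y|.
Proof.
have bnd (b c : R) : b - c <= `|b - c| /\ c - b <= `|b - c|.
  by rewrite ler_norm distrC ler_norm.
have lip_max (a b c : R) : `|Num.max a b - Num.max a c| <= `|b - c|.
  have [? ?] := bnd b c.
  by rewrite ler_norml /Num.max; case: ltP => ?; case: ltP => ?; lra.
have lip_min (a b c : R) : `|Num.min a b - Num.min a c| <= `|b - c|.
  have [? ?] := bnd b c.
  by rewrite ler_norml /Num.min; case: ltP => ?; case: ltP => ?; lra.
exact: le_trans (lip_max _ _ _) (lip_min _ _ _).
Qed.

Lemma val_unit_itv (s : unit_interval R) : 0 <= (\val s : R) <= 1.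
Proof. by have := valP s; rewrite inE /= in_itv. Qed.

Lemma to_unit_val (s : unit_interval R) : to_unit (\val s) = s.
Proof. by apply: val_inj; rewrite to_unitE// val_unit_itv. Qed.

Lemma clamp_continuous : continuous clamp.
Proof.
move=> z; apply/cvgrPdist_le => e e0; near=> y.
by apply: le_trans (clamp_lip z y) _; near: y; exact: cvgr_dist_le.
Unshelve. all: by end_near. Qed.

Lemma to_unit_continuous : continuous to_unit.
Proof.
move=> x A [B [[D oD <-] Bt] BA].
apply: (filterS BA).
have Dt : nbhs (clamp x : R) D by apply: open_nbhs_nbhs.
exact: (@clamp_continuous x D Dt).
Qed.

Lemma compact_unit_interval : compact [set: unit_interval R].
Proof.
have -> : [set: unit_interval R] = to_unit @` [set` `[0 : R, 1]].
  apply/seteqP; split => // s _.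
  by exists (\val s); [rewrite /= in_itv /= val_unit_itv|exact: to_unit_val].
apply: continuous_compact; last exact: segment_compact.
by apply: continuous_subspaceT; exact: to_unit_continuous.
Qed.

Lemma compact_cube : compact [set: cube R].
Proof.
have := @tychonoff nat (fun=> unit_interval R) (fun=> setT)
  (fun=> compact_unit_interval).
by congr compact; apply/seteqP; split.
Qed.

(** The interval has no isolated point. Properness makes limits along [s^'] unique, so that [lim] in
    [partial_derive] can be computed. *)
Global Instance unit_dnbhs_proper (s : unit_interval R) : ProperFilter s^'.
Proof.
apply: Build_ProperFilter_ex => A.
move=> [B [[D oD DB] Bs] BA].
have : nbhs (\val s : R) D by apply: open_nbhs_nbhs; split => //; rewrite -DB in Bs.
move=> /nbhs_ballP[e /= e0 eD].
have {}eD (w : R) : `|(\val s : R) - w| < e -> D w by exact: eD.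
have := val_unit_itv s; move: eD; move Ev : (\val s : R) => v eD /andP[v0 v1].
(* A step of at most 1/2 stays in [0,1] when taken upwards from the lower half or downwards from the
   upper half. *)
have [d [d0 de d1]] : exists d : R, [/\ 0 < d, d < e & d <= 1 / 2].
  exists (Num.min (e / 2) (1 / 2)); rewrite lt_min gt_min ge_min.
  by split; [lra|apply/orP; left; lra|rewrite lexx orbT].
have [r [r01 vr rv]] : exists r : R, [/\ 0 <= r <= 1, `|v - r| < e & r != v].
  have [v2|v2] := leP v (1 / 2).
    by exists (v + d); split; [|rewrite ltr_norml|rewrite gt_eqF//]; lra.
  by exists (v - d); split; [|rewrite ltr_norml|rewrite lt_eqF//]; lra.
exists (to_unit r); apply: BA.
  suff : D (clamp r) by rewrite -DB.
  by have -> : clamp r = r by [exact: to_unitE]; exact: eD.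
by apply: contra_neq rv => /(congr1 val); rewrite to_unitE// Ev.
Qed.

End cube_topology.

(** * Surfaces *)

Section surfaces.
Variables (R : realType) (X : completeNormedModType R).
Implicit Types (h : cube R -> X) (t : cube R).

Lemma dfwithC t i j (a b : unit_interval R) : i != j ->
  dfwith (dfwith t i a) j b = dfwith (dfwith t j b) i a.
Proof.
move=> ij; apply/funext => k.
have [<-|jk] := eqVneq j k.
  by rewrite dfwithin dfwithout// dfwithin.
rewrite [LHS]dfwithout//.
have [<-|ik] := eqVneq i k; first by rewrite !dfwithin.
by rewrite !dfwithout.
Qed.

Lemma dfwithK t i (a b : unit_interval R) :
  dfwith (dfwith t i a) i b = dfwith t i b.
Proof.
apply/funext => k.
have [<-|jk] := eqVneq i k; first by rewrite !dfwithin.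
by rewrite !dfwithout.
Qed.

Definition has_partial h j t (l : X) : Prop :=
  (\val s - \val (t j))^-1 *: (h (dfwith t j s) - h t) @[s --> (t j)^'] --> l.

Lemma has_partialE h j t l : has_partial h j t l -> partial_derive j h t = l.
Proof. by move=> hl; apply: cvg_lim. Qed.

Lemma has_partial_derivable h j t l : has_partial h j t l ->
  partial_derivable h j t.
Proof. by move=> hl; apply: cvgP hl. Qed.

Lemma has_partialD h1 h2 j t l1 l2 : has_partial h1 j t l1 ->
  has_partial h2 j t l2 -> has_partial (fun t => h1 t + h2 t) j t (l1 + l2).
Proof.
move=> h1l h2l; apply: cvg_trans (cvgD h1l h2l).
apply: near_eq_cvg; near=> s => /=.
by rewrite !fctE -scalerDr opprD addrACA.
Unshelve. all: by end_near. Qed.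

Lemma has_partialB h1 h2 j t l1 l2 : has_partial h1 j t l1 ->
  has_partial h2 j t l2 -> has_partial (fun t => h1 t - h2 t) j t (l1 - l2).
Proof.
move=> h1l h2l; apply: cvg_trans (cvgB h1l h2l).
apply: near_eq_cvg; near=> s => /=.
by rewrite !fctE -scalerBr !opprD !opprK addrACA.
Unshelve. all: by end_near. Qed.

Lemma has_partial_dfwith h n (a : unit_interval R) j t l : n != j ->
  has_partial h j (dfwith t n a) l ->
  has_partial (fun t => h (dfwith t n a)) j t l.
Proof.
move=> nj; rewrite /has_partial dfwithout// => hl; apply: cvg_trans hl.
apply: near_eq_cvg; near=> s => /=.
by rewrite (dfwithC _ _ _ nj).
Unshelve. all: by end_near. Qed.

Lemma has_partial_dfwith0 h n (a : unit_interval R) t :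
  has_partial (fun t => h (dfwith t n a)) n t 0.
Proof.
rewrite /has_partial; apply: cvg_near_cst; near=> s.
by rewrite dfwithK subrr scaler0.
Unshelve. all: by end_near. Qed.

Lemma has_partial_coord n (v : X) j t :
  has_partial (fun t => (\val (t n) : R) *: v) j t (if j == n then v else 0).
Proof.
rewrite /has_partial; apply: cvg_near_cst; near=> s.
have : s != t j by near: s; exact: withinT.
have [->|jn] := eqVneq j n => stj; last by rewrite dfwithout// subrr scaler0.
rewrite dfwithin -scalerBl scalerA mulVf ?scale1r// subr_eq0.
by apply: contra_neq stj => /val_inj.
Unshelve. all: by end_near. Qed.

Lemma dfwith_cvg (I : Type) (F : set_system I) (f : I -> cube R) t n a :
  Filter F -> f i @[i --> F] --> t ->
  (dfwith (f i) n a : cube R) @[i --> F] --> (dfwith t n a : cube R).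
Proof.
move=> FF ft; apply: cvg_cube => k.
have [<-|nk] := eqVneq n k.
  by under eq_fun do rewrite dfwithin; rewrite dfwithin; exact: cvg_cst.
under eq_fun do rewrite dfwithout//; rewrite dfwithout//.
exact: (@cvg_comp _ _ _ f (fun t : cube R => \val (t k) : R) _ (nbhs t)
  _ ft (@cube_coord_continuous R k t)).
Qed.

Lemma dfwith_continuousl n (a : unit_interval R) :
  continuous (fun t : cube R => dfwith t n a : cube R).
Proof.
move=> t.
exact: (@dfwith_cvg _ (nbhs t) id t n a (nbhs_filter t) (fun A At => At)).
Qed.

(** Each coordinate [k] is untouched once [n > k], so [dfwith t' n a] tends to [t] jointly as [t']
    tends to [t] and [n] to infinity. Compactness of the cube turns this local statement into a
    uniform one. *)
Lemma dfwith_near h (a : unit_interval R) (e : R) : continuous h -> 0 < e ->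
  \forall n \near \oo, forall t, `|h (dfwith t n a) - h t| <= e.
Proof.
move=> ch e0.
have /compact_near_coveringP cvr := @compact_cube R.
have : \forall n \near \oo, [set: cube R] `<=`
    (fun t => `|h (dfwith t n a) - h t| <= e).
  apply: cvr => t _.
  have e20 : 0 < e / 2 by rewrite divr_gt0.
  have h1 : \forall t' \near t & n \near \oo, `|h t - h (dfwith t' n a)| <= e / 2.
    apply: (@cvgr_dist_le _ _ _ (filter_prod (nbhs t) \oo) _
      (fun p : cube R * nat => h (dfwith p.1 p.2 a)) (h t)) => //.
    apply: (@cvg_comp _ _ _ (fun p : cube R * nat => dfwith p.1 p.2 a : cube R)
      h _ (nbhs t)); last exact: ch.
    apply: cvg_cube => k.
    have ck : (\val (p.1 k) : R) @[p --> filter_prod (nbhs t) \oo]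
        --> (\val (t k) : R).
      apply: (@cvg_comp _ _ _ (fun p : cube R * nat => p.1)
        (fun t : cube R => \val (t k) : R) _ (nbhs t)); first exact: cvg_fst.
      exact: cube_coord_continuous.
    have kn : \forall p \near filter_prod (nbhs t) \oo, (k < p.2)%N.
      exists ([set: cube R], [set n | (k < n)%N]).
        by split; [exact: filterT|exists k.+1].
      by move=> [? ?] [].
    apply: cvg_trans ck; apply: near_eq_cvg.
    near=> p; rewrite dfwithout// gtn_eqF//.
    by near: p.
  have h2 : \forall t' \near t & n \near \oo, `|h t - h t'| <= e / 2.
    exists ([set t' | `|h t - h t'| <= e / 2], [set: nat]).
      by split; [move/cvgrPdist_le : (ch t); exact|exact: filterT].
    by move=> [? ?] [].
  case: h1 => -[A1 B1] [/= tA1 B1n] AB1; case: h2 => -[A2 B2] [/= tA2 B2n] AB2.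
  exists (A1 `&` A2, B1 `&` B2) => /=; first by split; exact: filterI.
  move=> -[t' n] /= [[A1t A2t] [B1n' B2n']].
  have /= h1' := AB1 (t', n) (conj A1t B1n').
  have /= h2' := AB2 (t', n) (conj A2t B2n').
  have -> : h (dfwith t' n a) - h t' = (h t - h t') - (h t - h (dfwith t' n a)).
    by rewrite [RHS]addrC opprB addrA subrK.
  by rewrite [leRHS]splitr; apply: le_trans (ler_normB _ _) (lerD _ _).
by apply: filterS => n H t; exact: H.
Unshelve. all: by end_near. Qed.

End surfaces.

(** * Neighbourhoods in the space of surfaces and density of steep surfaces *)

Section Gamma_topology.
Variables (R : realType) (X : completeNormedModType R).
Implicit Types (h : cube R -> X) (t : cube R) (g : Gamma X).

(** Indexed like [Gamma_seminorm]: index 0 is the surface itself, and index [j.+1] its partial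
    derivative along coordinate [j]. *)
Definition jet k h t : X := if k is j.+1 then partial_derive j h t else h t.

Lemma Gamma_partial g j t : has_partial g j t (partial_derive j g t).
Proof. by have [_ /(_ j)[/(_ t)]] := set_mem (valP g). Qed.

Lemma Gamma_jet_continuous g k : continuous (jet k g).
Proof.
have [cg dg] := set_mem (valP g).
by case: k => [|j]; [exact: cg|have [] := dg j].
Qed.

Lemma jetB g1 g2 k t :
  jet k (fun t => g1 t - g2 t) t = jet k g1 t - jet k g2 t.
Proof.
case: k => [//|j] /=; apply: has_partialE.
by apply: has_partialB; exact: Gamma_partial.
Qed.

Lemma Gamma_seminormE g1 g2 k : Gamma_seminorm k (fun t => g1 t - g2 t) =
  sup (range (fun t => `|jet k g1 t - jet k g2 t|)).
Proof.
rewrite /Gamma_seminorm; congr sup; apply: eq_imagel => t _.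
by rewrite -jetB.
Qed.

(** Continuous functions on the compact cube are bounded. This makes the seminorms genuine suprema,
    since [sup] of an unbounded set is only a default value. *)
Lemma jet_dist_bounded g1 g2 k :
  has_sup (range (fun t => `|jet k g1 t - jet k g2 t|)).
Proof.
split; first by exists `|jet k g1 point - jet k g2 point|; exists point.
have : compact (range (fun t => `|jet k g1 t - jet k g2 t|)).
  apply: continuous_compact; last exact: compact_cube.
  apply: continuous_subspaceT => t.
  apply: (@cvg_norm _ _ _ (nbhs t)).
  by apply: cvgB; exact: Gamma_jet_continuous.
move=> /compact_bounded/pinfty_ex_gt0[M _ HM]; exists M => _ [t _ <-].
by apply: le_trans (ler_norm _) (HM _ _); exists t.
Qed.

Lemma Gamma_seminorm_ge g1 g2 k t :
  `|jet k g1 t - jet k g2 t| <= Gamma_seminorm k (fun t => g1 t - g2 t).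
Proof.
rewrite Gamma_seminormE; apply: ub_le_sup; last by exists t.
by have [] := jet_dist_bounded g1 g2 k.
Qed.

Lemma Gamma_seminorm_le g1 g2 k (e : R) :
  (forall t, `|jet k g1 t - jet k g2 t| <= e) ->
  Gamma_seminorm k (fun t => g1 t - g2 t) <= e.
Proof.
move=> ge; rewrite Gamma_seminormE; apply: ge_sup.
  by have [] := jet_dist_bounded g1 g2 k.
by move=> _ [t _ <-].
Qed.

(** The expected neighbourhoods of [g0], given by finitely many seminorms and one tolerance. They
    form a filter, which makes finite intersections of subbasic balls easy to handle. *)
Definition close_jets (g0 : Gamma X) (A : set (Gamma X)) : Prop :=
  exists m : nat, exists2 e : R, 0 < e & forall g,
    (forall k, (k <= m)%N -> forall t, `|jet k g t - jet k g0 t| <= e) -> A g.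

Global Instance close_jets_filter g0 : Filter (close_jets g0).
Proof.
split; first by exists 0%N, 1.
  move=> A B [m [e e0 eA]] [m' [e' e'0 eB]].
  exists (maxn m m'), (Num.min e e'); first by rewrite lt_min e0.
  move=> g H; split; [apply: eA|apply: eB] => k km t.
    have := H k _ t; rewrite le_min leq_max km => /(_ isT).
    by move=> /andP[].
  have := H k _ t; rewrite le_min leq_max km orbT => /(_ isT).
  by move=> /andP[].
by move=> A B AB [m [e e0 eA]]; exists m, e => // g /eA /AB.
Qed.

Lemma open_close_jets (A : set (Gamma X)) g0 : open A -> A g0 -> close_jets g0 A.
Proof.
move=> [D sD <-] [C DC Cg0].
apply: (@filterS _ _ _ C); first by move=> g Cg; exists C.
have [K sK KC] := sD _ DC; rewrite -KC.
apply: filter_bigI => E KE.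
have [k [g1 [e [e0 EE]]]] := set_mem (sK E KE).
have Eg0 : E g0 by move: Cg0; rewrite -KC; exact.
rewrite EE /Gamma_ball /= in Eg0 *.
set r := Gamma_seminorm k (fun t => g0 t - g1 t) in Eg0.
(* The subbasic ball is centred at [g1], not at [g0]. Half of the margin [e - r] keeps the
   inequality strict after passing to the supremum. *)
exists k, ((e - r) / 2); first by rewrite divr_gt0// subr_gt0.
move=> g Hg; apply: (@le_lt_trans _ _ ((e - r) / 2 + r)); last first.
  by move: Eg0; lra.
apply: Gamma_seminorm_le => t.
apply: le_trans (ler_distD (jet k g0 t) _ _) _.
by rewrite lerD ?Gamma_seminorm_ge// Hg.
Qed.

Lemma open_Gamma_ball k g (e : R) : 0 < e -> open (Gamma_ball k g e).
Proof.
move=> e0; exists [set Gamma_ball k g e]; last by rewrite bigcup_set1.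
move=> _ ->; exists (finmap.fset1 (Gamma_ball k g e)).
  by move=> B; rewrite finmap.inE => /eqP ->; apply/mem_set; exists k, g, e.
by rewrite set_fset1 bigcap_set1.
Qed.

Definition mk_Gamma h (hG : Gamma_set h) : Gamma X := exist _ h (mem_set hG).

Lemma coord_mul_continuous n (v : X) :
  continuous (fun t => (\val (t n) : R) *: v).
Proof.
move=> t; apply: (@cvgZ _ _ _ (nbhs t)); first exact: cube_coord_continuous.
exact: (@cvg_cst _ _ _ (nbhs t)).
Qed.

Lemma coord_surface_Gamma n (v : X) :
  Gamma_set (fun t => (\val (t n) : R) *: v).
Proof.
split=> [|j]; first exact: coord_mul_continuous.
split=> [t|]; first by apply: has_partial_derivable; exact: has_partial_coord.
rewrite (_ : partial_derive j _ = fun=> if j == n then v else 0).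
  by move=> t; exact: (@cvg_cst _ _ _ (nbhs t)).
by apply/funext => t; apply: has_partialE; exact: has_partial_coord.
Qed.

Definition coord_surface n (v : X) := mk_Gamma (coord_surface_Gamma n v).

Lemma jet_coord_surface n v t : jet n.+1 (coord_surface n v) t = v.
Proof.
by rewrite /jet (has_partialE (@has_partial_coord _ _ n v n t)) eqxx.
Qed.

(** Freezing coordinate [n] removes the dependence of [g] on it, so the added term makes the partial
    derivative along [n] exactly [v]. *)
Definition tilt g n (a : unit_interval R) (v : X) t :=
  g (dfwith t n a) + (\val (t n) : R) *: v.

Lemma has_partial_tilt g n a v j t : has_partial (tilt g n a v) j t
  (if j == n then v else partial_derive j g (dfwith t n a)).
Proof.
have -> : (if j == n then v else partial_derive j g (dfwith t n a)) =
    (if j == n then 0 else partial_derive j g (dfwith t n a)) +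
    (if j == n then v else 0) by case: ifP; rewrite ?add0r ?addr0.
apply: has_partialD; last exact: has_partial_coord.
have [->|jn] := eqVneq j n; first exact: has_partial_dfwith0.
apply: has_partial_dfwith; first by rewrite eq_sym.
exact: Gamma_partial.
Qed.

Lemma tilt_Gamma g n a v : Gamma_set (tilt g n a v).
Proof.
have dfwith_comp (h : cube R -> X) : continuous h ->
    continuous (fun t => h (dfwith t n a)).
  move=> ch t.
  exact: (@cvg_comp _ _ _ (fun t : cube R => dfwith t n a : cube R) h
    (nbhs t) (nbhs (dfwith t n a : cube R)) _ (@dfwith_continuousl R n a t) (ch _)).
split=> [t|j].
  apply: (@cvgD _ _ _ (nbhs t)); last exact: coord_mul_continuous.
  by apply: dfwith_comp; exact: (@Gamma_jet_continuous g 0).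
split=> [t|]; first by apply: has_partial_derivable; exact: has_partial_tilt.
rewrite (_ : partial_derive j _ =
    fun t => if j == n then v else partial_derive j g (dfwith t n a)); last first.
  by apply/funext => t; apply: has_partialE; exact: has_partial_tilt.
case: (j == n); first by move=> t; exact: (@cvg_cst _ _ _ (nbhs t)).
by apply: dfwith_comp; exact: (@Gamma_jet_continuous g j.+1).
Qed.

(** The coordinate surface has constant partial derivative [p.2 *: u] along [p.1], so this ball is a
    uniform condition on that derivative alone. The scale [p.2] is free, which lets the tilt be
    arbitrarily small, and the tolerance [p.2 * d] is relative to it. *)
Definition steep (u : X) (d : R) : set (Gamma X) :=
  \bigcup_(p in [set p : nat * R | 0 < p.2])
    Gamma_ball p.1.+1 (coord_surface p.1 (p.2 *: u)) (p.2 * d).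

Lemma open_steep u d : 0 < d -> open (steep u d).
Proof.
by move=> d0; apply: bigcup_open => p p0; apply: open_Gamma_ball; exact: mulr_gt0.
Qed.

Lemma dense_steep u d : 0 < d -> dense (steep u d).
Proof.
move=> d0 A [g0' Ag0] oA; pose g0 : Gamma X := g0'.
have [m [e e0 gA]] := open_close_jets oA Ag0.
have e20 : 0 < e / 2 by rewrite divr_gt0.
have near_m (k : 'I_m.+1) : \forall n \near \oo, forall t,
    `|jet k g0 (dfwith t n point) - jet k g0 t| <= e / 2.
  by apply: dfwith_near => //; exact: Gamma_jet_continuous.
(* With [m <= n], the seminorm of index [n.+1], the only one in which the slope of the tilt appears
   as a derivative, is not among those to be kept small. *)
have [n [mn Hn]] : exists n, (m <= n)%N /\ forall (k : 'I_m.+1) t,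
    `|jet k g0 (dfwith t n point) - jet k g0 t| <= e / 2.
  have [N _ HN] := filter_forall _ near_m.
  exists (maxn m N); split; first exact: leq_maxl.
  by move=> k t; apply: HN; rewrite /= leq_maxr.
have u0 : 0 < `|u| + 1 by rewrite ltr_wpDl.
(* This gives [eta * |u| <= e / 2]; the added 1 keeps the denominator positive when [u = 0]. *)
pose eta := e / 2 / (`|u| + 1).
have eta0 : 0 < eta by rewrite divr_gt0.
pose g := mk_Gamma (tilt_Gamma g0 n point (eta *: u)).
exists g; split.
  apply: gA => -[|j] km t.
    rewrite /jet /= /tilt addrAC; apply: le_trans (ler_normD _ _) _.
    rewrite [leRHS]splitr; apply: lerD; first exact: (Hn ord0).
    have ne : `|eta| = eta by exact: gtr0_norm.
    rewrite normrZ normrZ ne; have /andP[s0 s1] := val_unit_itv (t n).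
    rewrite ger0_norm//; apply: (@le_trans _ _ (1 * (eta * `|u|))).
      by rewrite ler_wpM2r// mulr_ge0// ltW.
    rewrite mul1r /eta mulrAC ler_pdivrMr// ler_wpM2l ?lerDl//; exact: ltW.
  rewrite /jet /= (has_partialE (@has_partial_tilt g0 n point (eta *: u) _ t)).
  rewrite ltn_eqF; last exact: leq_trans km mn.
  apply: le_trans (Hn (Ordinal (km : (j.+1 < m.+1)%N)) t) _.
  by rewrite ler_pdivrMr// ler_peMr ?ltW// ltr1n.
exists (n, eta) => //=; apply: (@le_lt_trans _ _ 0); last exact: mulr_gt0.
apply: Gamma_seminorm_le => t; rewrite jet_coord_surface.
rewrite /jet /= (has_partialE (@has_partial_tilt g0 n point (eta *: u) _ t)).
by rewrite eqxx subrr normr0.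
Qed.

End Gamma_topology.

(** * Fubini on the cube *)

Section product_lebesgue_fubini.
Variable R : realType.

Definition box (m : nat) (B : nat -> set R) : set (cube R) :=
  [set t | forall i, (i < m)%N -> B i (\val (t i))].

Definition boxes : set_system (cube R) := [set A | exists m B,
  (forall i, (i < m)%N -> measurable (B i)) /\ A = box m B].

Lemma box_widen m m' B : (m <= m')%N ->
  box m B = box m' (fun i => if (i < m)%N then B i else setT).
Proof.
move=> mm'; apply/seteqP; split => t tB i im.
  by case: ifPn => // im'; exact: tB.
by have := tB i (leq_trans im mm'); rewrite im.
Qed.

Lemma boxes_setI : setI_closed boxes.
Proof.
move=> _ _ [m [B [mB ->]]] [m' [B' [mB' ->]]].
exists (maxn m m'), (fun i => (if (i < m)%N then B i else setT) `&`
                              (if (i < m')%N then B' i else setT)); split.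
  move=> i _; apply: measurableI; case: ifP => // ?; [exact: mB|exact: mB'].
rewrite (box_widen B (leq_maxl m m')) (box_widen B' (leq_maxr m m')).
apply/seteqP; split => [t [tB tB'] i im|t tB].
  by split; [exact: tB|exact: tB'].
by split => i im; have [] := tB i im.
Qed.

Lemma cube_coord_measurable k :
  measurable_fun setT (fun t : borel (cube R) => \val (t k) : R).
Proof.
apply: (measurability _ (RGenOpens.measurableE R)).
move=> _ [_ [a [b ->] <-]]; rewrite setTI; apply: sub_sigma_algebra.
have /continuousP := @cube_coord_continuous R k; apply; exact: interval_open.
Qed.

Lemma measurable_box m B : (forall i, (i < m)%N -> measurable (B i)) ->
  measurable (box m B : set (borel (cube R))).
Proof.
move=> mB; rewrite (_ : box m B = \bigcap_(i in `I_m)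
    ((fun t : borel (cube R) => \val (t i) : R) @^-1` B i)); last first.
  by apply/seteqP; split.
apply: fin_bigcap_measurable => // i im; rewrite -[X in measurable X]setTI.
by apply: cube_coord_measurable => //; exact: mB.
Qed.

(** If every box met the complement of [U], chosen points of these intersections would converge to
    [t] coordinatewise. One index [m] controls both the number of constrained coordinates and the
    radius. *)
Lemma nbhs_cube_box (t : cube R) (U : set (cube R)) : nbhs t U ->
  exists m : nat, box m.+1 (fun i => ball (\val (t i) : R) m.+1%:R^-1) `<=` U.
Proof.
move=> tU; apply: contrapT => H.
have {}H (m : nat) : exists t',
    box m.+1 (fun i => ball (\val (t i) : R) m.+1%:R^-1) t' /\ ~ U t'.
  apply: contrapT => H'; apply: H; exists m => t' tt'; apply: contrapT => Ut'.
  by apply: H'; exists t'.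
have [u Hu] := choice H.
have ut : u m @[m --> \oo] --> t.
  apply: cvg_cube => k; apply/cvgrPdist_lt => e e0; near=> m.
  have [+ _] := Hu m => /(_ k); rewrite -ball_normE /= => um.
  apply: lt_trans (um _) _.
    by rewrite ltnS; near: m; exact: nbhs_infty_ge.
  by near: m; apply: near_infty_natSinv_lt (PosNum e0).
have /ut[N _ NU] := tU.
by have [_] := Hu N; apply; exact: (NU N (leqnn N)).
Unshelve. all: by end_near. Qed.

(** Every open set is a union of boxes with rational sides, and there are countably many of these.
    Hence boxes, which are stable under intersection, determine finite Borel measures on the
    cube. *)
Lemma borel_cubeE : @measurable _ (borel (cube R)) = <<s boxes >>.
Proof.
apply/seteqP; split; last first.
  apply: smallest_sub; first exact: sigma_algebra_measurable.
  by move=> _ [m [B [mB ->]]]; exact: measurable_box.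
apply: smallest_sub; first exact: smallest_sigma_algebra.
move=> U oU.
pose rbox (s : seq (rat * rat)) := box (size s) (fun i =>
  `]ratr (nth (0, 0) s i).1, ratr (nth (0, 0) s i).2[%classic : set R).
have -> : U = \bigcup_(s in [set s | rbox s `<=` U]) rbox s.
  apply/seteqP; split; last by move=> t [s sU]; exact: sU.
  move=> t Ut.
  have [m mU] := nbhs_cube_box (open_nbhs_nbhs (conj oU Ut)).
  have m0 : (0 : R) < m.+1%:R^-1 by rewrite invr_gt0 ltr0n.
  have Hq i : exists p : rat * rat,
      (\val (t i) : R) - m.+1%:R^-1 < ratr p.1 < (\val (t i) : R) /\
      (\val (t i) : R) < ratr p.2 < (\val (t i) : R) + m.+1%:R^-1.
    have [a] := @rat_in_itvoo R (\val (t i) - m.+1%:R^-1) (\val (t i))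
      ltac:(by rewrite ltrBlDr ltrDl).
    have [b] := @rat_in_itvoo R (\val (t i)) (\val (t i) + m.+1%:R^-1)
      ltac:(by rewrite ltrDl).
    by rewrite !in_itv /= => Hb Ha; exists (a, b).
  have [p Hp] := choice Hq.
  exists (mkseq p m.+1); last first.
    move=> i; rewrite size_mkseq => im /=; rewrite in_itv /= nth_mkseq//.
    by have [/andP[_ ->] /andP[-> _]] := Hp i.
  move=> t' Ht'; apply: mU => i im.
  have := Ht' i; rewrite size_mkseq => /(_ im) /=; rewrite in_itv /= nth_mkseq//.
  have [/andP[h1 _] /andP[_ h2]] := Hp i.
  move=> /andP[h3 h4].
  have dist_lt (a v w q r : R) :
      v - a < q -> q < w -> w < r -> r < v + a -> `|v - w| < a.
    by rewrite ltr_norml; lra.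
  by rewrite -ball_normE; exact: dist_lt h1 h3 h4 h2.
have mU : @measurable _ (g_sigma_algebraType boxes)
    (\bigcup_(s in [set s | rbox s `<=` U]) rbox s).
  rewrite bigcup_mkcond; apply: countable_bigcupT_measurable => // s.
  case: ifP => // _; apply: sub_sigma_algebra; eexists; eexists; split; last by [].
  by move=> i _; exact: measurable_itv.
exact: mU.
Qed.

Lemma box_splice m n B (t : cube R) (s : R) : (n < m)%N ->
  box m B (dfwith t n (to_unit s)) <->
  box m (fun i => if i == n then setT else B i) t /\ B n (clamp s).
Proof.
move=> nm; split=> [H|[H Bn] i im].
  split; last by have := H n nm; rewrite dfwithin.
  by move=> i im; case: ifPn => // ni; have := H i im; rewrite dfwithout// eq_sym.
have [->|ni] := eqVneq i n; first by rewrite dfwithin.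
by have /= := H i im; rewrite (negbTE ni) dfwithout 1?eq_sym//.
Qed.

Lemma clamp_measurable : measurable_fun setT (@clamp R).
Proof.
by apply: continuous_measurable_fun; exact: clamp_continuous.
Qed.

(** Replaces coordinate [n] by an independent parameter; under the product of [mu] with Lebesgue
    measure on [0,1] this resamples the coordinate. *)
Definition splice n (p : borel (cube R) * R) : borel (cube R) :=
  dfwith (p.1 : cube R) n (to_unit p.2).

Lemma splice_box n m B : (n < m)%N -> splice n @^-1` (box m B) =
  box m (fun i => if i == n then setT else B i) `*` (@clamp R @^-1` B n).
Proof.
by move=> nm; apply/seteqP; split => -[t s]; move=> /(box_splice _ _ _ nm).
Qed.

Lemma splice_measurable n : measurable_fun setT (splice n).
Proof.
apply: (measurability _ borel_cubeE).
move=> _ [_ [m [B [mB ->]] <-]]; rewrite setTI.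
rewrite (box_widen B (leq_maxl m n.+1)) splice_box ?leq_maxr//.
have mB' i : measurable (if (i < m)%N then B i else setT).
  by case: ifPn => // im; exact: mB.
apply: measurableX.
  by apply: measurable_box => i _; case: ifPn.
by rewrite -[X in measurable X]setTI; exact: clamp_measurable.
Qed.

Lemma clamp_id (x : R) : `[0, 1]%classic x -> clamp x = x.
Proof. by rewrite /= in_itv => x01; exact: to_unitE. Qed.

Lemma lebesgue_measure_unit : @lebesgue_measure R `[0, 1]%classic = 1%E.
Proof. by rewrite lebesgue_measure_itv /= lte01 sube0. Qed.

Variable mu : probability (borel (cube R)) R.
Hypothesis muE : product_lebesgue mu.

Lemma product_lebesgue_box m (B : nat -> set R) :
  (forall i, (i < m)%N -> measurable (B i)) ->
  mu (box m B) = (\prod_(i < m) fine (lebesgue_measure (B i `&` `[0, 1])))%:E.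
Proof. exact: muE. Qed.

(** Resampling coordinate [n] uniformly preserves [mu], because the image measure agrees with [mu]
    on boxes. So [mu A] is the integral of the measures of the sections of [A] along that
    coordinate. *)
Lemma product_lebesgue_null_sections n (A : set (borel (cube R))) :
  measurable A ->
  (forall t : cube R, (@lebesgue_measure R).-negligible
    [set s | A (dfwith t n (to_unit s)) /\ 0 < s < 1]) ->
  mu A = 0%E.
Proof.
move=> mA A0.
pose lam := @lebesgue_measure R.
have mD : measurable ([set: borel (cube R)] `*` `[0 : R, 1]%classic).
  exact: measurableX.
pose nu := pushforward (mrestr (mu \x lam)%E mD) (splice n).
have nuE B m : (n < m)%N -> (forall i, (i < m)%N -> measurable (B i)) ->
    nu (box m B) = mu (box m B).
  move=> nm mB; rewrite /nu /pushforward /= /mrestr splice_box// -setXI setIT.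
  rewrite product_measure1E//; last 2 first.
  - by apply: measurable_box => i im; case: ifPn => // _; exact: mB.
  - apply: measurableI => //; rewrite -[X in measurable X]setTI.
    by apply: clamp_measurable => //; exact: mB.
  have -> : @clamp R @^-1` B n `&` `[0, 1]%classic = B n `&` `[0, 1]%classic.
    by apply/seteqP; split => s [Bs s01]; split => //;
      move: Bs; rewrite /= clamp_id.
  have mB' i : (i < m)%N -> measurable (if i == n then setT else B i).
    by move=> im; case: ifPn => // _; exact: mB.
  rewrite (product_lebesgue_box mB) [X in (X * _)%E](product_lebesgue_box mB').
  have fin : lam (B n `&` `[0, 1]%classic) \is a fin_num.
    rewrite ge0_fin_numE//; apply: (@le_lt_trans _ _ (lam `[0, 1]%classic)).
      by apply: measureIr => //; exact: mB.
    by rewrite /lam lebesgue_measure_unit ltry.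
  rewrite -[X in (_ * X)%E](fineK fin) -EFinM; congr EFin.
  (* Side [n] of the spliced box is the whole interval and contributes 1; the Lebesgue factor
     supplies the measure of [B n] in its place. *)
  rewrite (bigD1 (Ordinal nm))//= eqxx setTI lebesgue_measure_unit mul1r.
  rewrite [RHS](bigD1 (Ordinal nm))//= mulrC; congr (_ * _).
  apply: eq_bigr => i; rewrite -val_eqE /= => /negbTE ->.
  by [].
(* The measure structure of [pushforward] depends on a proof of measurability
   that unification cannot supply. *)
pose nu' : {measure set (borel (cube R)) -> \bar R} :=
  @measure_function_pushforward__canonical__measure_function_Measure
    _ _ _ _ _ (mrestr (mu \x lam)%E mD) (splice n) (@splice_measurable n).
have -> : mu A = nu A.
  apply/esym.
  have Bg (k : nat) : boxes (box n.+1 (fun=> [set: R])).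
    by exists n.+1, (fun=> setT).
  have Bc : \bigcup_(k in [set: nat]) box n.+1 (fun=> [set: R]) = setT.
    by rewrite bigcup_const//; apply/seteqP; split.
  have := @measure_unique _ R (borel (cube R)) boxes
    (fun=> box n.+1 (fun=> setT)) borel_cubeE boxes_setI Bg Bc nu' mu.
  apply => //.
  - move=> _ [m [B [mB ->]]]; rewrite (box_widen B (leq_maxl m n.+1)).
    by apply: nuE => [|i _]; [rewrite leq_maxr|case: ifPn => // im; exact: mB].
  - move=> _; apply: (@le_lt_trans _ _ (mu (box n.+1 (fun=> setT)))).
      have nuT : nu (box n.+1 (fun=> setT)) = mu (box n.+1 (fun=> setT)).
        by apply: nuE => // i _; exact: measurableT.
      by rewrite -[leLHS]/(nu (box n.+1 (fun=> setT))) nuT.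
    by apply: le_lt_trans (probability_le1 mu _) _; rewrite ?ltry//;
      exact: measurable_box.
rewrite /nu /pushforward /= /mrestr /product_measure1.
have mS : measurable
    (splice n @^-1` A `&` ([set: borel (cube R)] `*` `[0 : R, 1]%classic)).
  apply: measurableI => //; rewrite -[X in measurable X]setTI.
  exact: splice_measurable.
apply: integral0_eq => t _ /=.
suff neg : (@lebesgue_measure R).-negligible
    (xsection (splice n @^-1` A `&` ([set: borel (cube R)] `*` `[0 : R, 1]%classic)) t).
  by apply: measure_negligible => //; exact: measurable_xsection.
(* The hypothesis covers only interior parameters; the two endpoints add a null set. *)
have neg01 : (@lebesgue_measure R).-negligible
    ([set s | A (dfwith t n (to_unit s)) /\ 0 < s < 1] `|` ([set 0] `|` [set 1])).
  apply: negligibleU; first exact: A0.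
  by apply: negligibleU; apply/negligibleP => //; exact: lebesgue_measure_set1.
apply: negligibleS neg01 => s.
rewrite xsectionE /= => -[As [_]]; rewrite in_itv /= => /andP[s0 s1].
have [->|s0'] := eqVneq s 0; first by right; left.
have [->|s1'] := eqVneq s 1; first by right; right.
by left; split => //; rewrite !lt_neqAle eq_sym s0' s0 s1' s1.
Qed.

End product_lebesgue_fubini.

(** * Oscillation of difference quotients *)

Section locally_lipschitz_line.
Variables (R : realType) (V : normedModType R).

(** A substitute for the mean value inequality: the bound from [a] persists at the supremum [c] of
    the points where it holds, and the local bound at [c] carries it further unless [c = b]. *)
Lemma lipschitz_line (F : R -> V) (M : R) :
  (forall x, exists2 r, 0 < r &
    forall y, `|y - x| < r -> `|F y - F x| <= M * `|y - x|) ->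
  forall x y, `|F x - F y| <= M * `|x - y|.
Proof.
move=> loc.
suff le_case a b : a <= b -> `|F b - F a| <= M * (b - a).
  move=> x y; have [xy|/ltW yx] := leP x y.
    by rewrite distrC (distrC x) ger0_norm ?subr_ge0//; exact: le_case.
  by rewrite ger0_norm ?subr_ge0//; exact: le_case.
move=> ab.
pose S := [set x | a <= x <= b /\ `|F x - F a| <= M * (x - a)].
have Sa : S a by split; [rewrite lexx|rewrite !subrr normr0 mulr0].
have ubS : ubound S b by move=> x [/andP[]].
have supS : has_sup S by split; [exists a|exists b].
pose c := sup S.
have ac : a <= c by apply: ub_le_sup => //; exists b.
have cb : c <= b by apply: ge_sup => //; exists a.
have [r r0 rc] := loc c.
have Sc : S c.
  split; first by rewrite ac cb.
  have [x Sx xc] := sup_adherent r0 supS.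
  have xlec : x <= c by apply: ub_le_sup => //; exists b.
  have [_ Fx] := Sx.
  apply: le_trans (ler_distD (F x) _ _) _.
  have : `|F x - F c| <= M * `|x - c|.
    by apply: rc; rewrite distrC ger0_norm ?subr_ge0// ltrBlDr addrC -ltrBlDr.
  rewrite distrC (distrC x) (ger0_norm (_ : 0 <= c - x)) ?subr_ge0// => FcFx.
  by apply: le_trans (lerD FcFx Fx) _; rewrite -mulrDr addrA subrK.
have [cb'|] := ltP c b; last by move=> bc; have [_] := Sc; have <- : c = b by lra.
pose y := Num.min b (c + r / 2).
have r20 : 0 < r / 2 by rewrite divr_gt0.
have cy : c < y by rewrite lt_min cb' ltrDl.
have yb : y <= b by rewrite ge_min lexx.
have ycr : y <= c + r / 2 by rewrite ge_min lexx orbT.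
have Sy : S y.
  split; first by rewrite yb (le_trans ac) ?ltW.
  have [_ Fc] := Sc.
  apply: le_trans (ler_distD (F c) _ _) _.
  have : `|F y - F c| <= M * `|y - c|.
    by apply: rc; rewrite ger0_norm ?subr_ge0 ?ltW//; lra.
  have yc0 : 0 <= y - c by rewrite subr_ge0 ltW.
  rewrite (ger0_norm yc0) => FyFc.
  by apply: le_trans (lerD FyFc Fc) _; rewrite -mulrDr addrA subrK.
have : y <= c by apply: ub_le_sup => //; exists b.
by rewrite leNgt cy.
Qed.

End locally_lipschitz_line.

Section directional.
Variables (R : realType) (X Y : completeNormedModType R).
Implicit Types (h : X -> Y) (x u : X) (s t e L : R).

Definition lipschitz_with h L : Prop := forall x y, `|h x - h y| <= L * `|x - y|.

Definition quotient h u x t : Y := t^-1 *: (h (x + t *: u) - h x).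

(** A Cauchy condition that names no limit: for all [e] it means, [Y] being complete, that the
    derivative in direction [u] exists, and for fixed [e] it defines a Borel set when [h] is
    continuous. *)
Definition oscillates_within h u e x : Prop := exists2 d, 0 < d & forall s t,
  0 < `|s| < d -> 0 < `|t| < d -> `|quotient h u x s - quotient h u x t| <= e.

Lemma lipschitz_with_continuous h L : lipschitz_with h L -> continuous h.
Proof.
move=> hL x; apply/cvgrPdist_lt => e e0.
have L0 : 0 < `|L| + 1 by rewrite ltr_wpDl.
near=> y; apply: le_lt_trans (hL x y) _.
apply: (@le_lt_trans _ _ ((`|L| + 1) * `|x - y|)).
  by rewrite ler_wpM2r// (le_trans (ler_norm _))// lerDl.
rewrite mulrC -ltr_pdivlMr//; near: y.
by apply: cvgr_dist_lt => //; rewrite divr_gt0.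
Unshelve. all: by end_near. Qed.

Lemma continuous_quotient h u t : continuous h -> continuous (quotient h u ^~ t).
Proof.
move=> ch x; apply: cvgZ; first exact: cvg_cst.
apply: cvgB; last exact: ch.
apply: (@cvg_comp _ _ _ (fun x => x + t *: u) h); last exact: ch.
by apply: cvgD; [exact: cvg_id|exact: cvg_cst].
Qed.

(** For a fixed radius the condition is an intersection of closed ones, and radii [k.+1%:R^-1]
    suffice, so the oscillation set is a countable union of closed sets. *)
Lemma measurable_oscillation h u e : continuous h ->
  measurable ([set x | ~ oscillates_within h u e x] : set (borel X)).
Proof.
move=> ch; apply: measurableC.
have -> : oscillates_within h u e = \bigcup_k
    [set x | forall s t, 0 < `|s| < k.+1%:R^-1 -> 0 < `|t| < k.+1%:R^-1 ->
      `|quotient h u x s - quotient h u x t| <= e].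
  apply/seteqP; split => x.
    move=> [d d0 xd]; near \oo => k; exists k => //.
    have kd : k.+1%:R^-1 < d by near: k; exact: (near_infty_natSinv_lt (PosNum d0)).
    move=> s t /andP[s0 sd] /andP[t0 td].
    by apply: xd; rewrite ?s0 ?t0 (lt_trans _ kd).
  by move=> [k _ xk]; exists k.+1%:R^-1; [rewrite invr_gt0 ltr0n|exact: xk].
apply: bigcupT_measurable => k.
rewrite -[X in measurable X]setCK; apply: measurableC; apply: sub_sigma_algebra.
apply: closed_openC.
rewrite (_ : [set x | _] = \bigcap_(p in [set p : R * R |
    0 < `|p.1| < k.+1%:R^-1 /\ 0 < `|p.2| < k.+1%:R^-1])
    ((fun x => `|quotient h u x p.1 - quotient h u x p.2|) @^-1` [set r | r <= e])).
  apply: closed_bigI => p _; apply: closed_comp; last exact: closed_le.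
  move=> x _; apply: cvg_norm; apply: cvgB; exact: continuous_quotient.
apply/seteqP; split => x /= H; first by move=> [s t] [/= ? ?]; exact: H.
by move=> s t ? ?; apply: (H (s, t)).
Unshelve. all: by end_near. Qed.

End directional.

(** * Lipschitz maps along steep surfaces *)

Section steep_surfaces.
Variables (R : realType) (X Y : completeNormedModType R).
Variable mu : probability (borel (cube R)) R.
Hypothesis muE : product_lebesgue mu.
Hypothesis RNP : Radon_Nikodym_property Y.
Implicit Types (h : X -> Y) (u : X) (g : Gamma X).

Lemma near_to_unit (s0 : R) (P : set (unit_interval R)) :
  (\forall s \near (to_unit s0)^', P s) ->
  \forall s \near s0, to_unit s != to_unit s0 -> P (to_unit s).
Proof. by move=> H; have := @to_unit_continuous R s0 _ H. Qed.

Lemma Gamma_line_expansion g n (v : X) (r : R) t (s0 : R) :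
  (forall t, `|partial_derive n g t - v| < r) ->
  \forall s \near s0, `|g (dfwith t n (to_unit s)) - g (dfwith t n (to_unit s0))
    - (clamp s - clamp s0) *: v| <= r * `|clamp s - clamp s0|.
Proof.
move=> gr; pose t0 : cube R := dfwith t n (to_unit s0).
have t0n : t0 n = to_unit s0 by rewrite /t0 dfwithin.
have dr := gr t0; set D := partial_derive n g t0 in dr.
have rD : 0 < r - `|D - v| by rewrite subr_gt0.
(* The strict bound on the derivative at [t0] leaves the margin [r - |D - v|] for the remainder of
   the difference quotient. *)
have /cvgrPdist_le/(_ _ rD) := @Gamma_partial R X g n t0.
rewrite t0n => /near_to_unit.
(* [to_unit] is not injective outside [0,1]: when [s] and [s0] give the same point there is no
   quotient to use, but both sides vanish. *)
apply: filterS => s; have [ss0 _|ss0 /(_ isT)] := eqVneq (to_unit s) (to_unit s0).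
  have := congr1 val ss0 => /= ->; rewrite ss0 !subrr scale0r subr0 !normr0.
  by rewrite mulr0.
rewrite -/D /t0 dfwithK -/t0 /=.
set w := clamp s - clamp s0.
have w0 : w != 0.
  by rewrite subr_eq0; apply: contra_neq ss0 => ss0; apply: val_inj.
set q := g _ - g _ => Dq.
have -> : q - w *: v = w *: (w^-1 *: q - v) by rewrite scalerBr scalerA mulfV// scale1r.
rewrite normrZ mulrC ler_wpM2r//.
rewrite -(subrK D (w^-1 *: q)) -addrA; apply: le_trans (ler_normD _ _) _.
by rewrite -lerBrDr distrC.
Qed.

Lemma Gamma_line_lipschitz g n (v : X) (r : R) t :
  (forall t, `|partial_derive n g t - v| < r) ->
  forall s s', `|g (dfwith t n (to_unit s)) - g (dfwith t n (to_unit s'))| <=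
    (`|v| + r) * `|s - s'|.
Proof.
move=> gr.
have r0 : 0 < r by apply: le_lt_trans (gr point).
apply: lipschitz_line => s0.
have /nbhs_ballP[d /= d0 Hd] := Gamma_line_expansion t s0 gr.
exists d => // s ss0.
have /Hd : ball s0 d s by rewrite -ball_normE /= distrC.
set q := g _ - g _ => qr.
have := clamp_lip s s0; set w := clamp s - clamp s0 in qr *.
rewrite -(subrK (w *: v) q) => ws.
apply: le_trans (ler_normD _ _) _.
rewrite mulrDl addrC; apply: lerD.
  by rewrite normrZ mulrC ler_wpM2l.
by apply: le_trans qr _; rewrite ler_wpM2l// ltW.
Qed.

(** Moving the parameter by [tau] moves [g] by [(tau * eta) *: u] up to [eta * d * |tau|]. Hence the
    quotient of the composite at [tau] differs from [eta] times the quotient of [h] at [tau * eta]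
    by at most [L * eta * d], while the former converges. *)
Lemma steep_line_differentiable h (L : R) u (e d eta : R) g n t (s0 : R) :
  lipschitz_with h L -> 0 < e -> 0 < d -> 4 * L * d <= e -> 0 <= L -> 0 < eta ->
  (forall t, `|partial_derive n g t - eta *: u| < eta * d) ->
  0 < s0 < 1 ->
  derivable (fun s => h (g (dfwith t n (to_unit s)))) s0 1 ->
  oscillates_within h u e (g (dfwith t n (to_unit s0))).
Proof.
move=> hL e0 d0 Lde L0 eta0 gr /andP[s00 s01] /cvg_ex[l /cvgrPdist_le].
have ee0 : 0 < eta * e / 4 by rewrite divr_gt0// mulr_gt0.
move=> /(_ _ ee0) /nbhs_ballP[r1 /= r10 Hr1].
have /nbhs_ballP[r2 /= r20 Hr2] := Gamma_line_expansion t s0 gr.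
(* The last two bounds keep [s0 + tau] inside [0,1], where [clamp] is the identity. *)
pose r := Num.min (Num.min r1 r2) (Num.min s0 (1 - s0)).
have r0 : 0 < r by rewrite !lt_min r10 r20 s00 subr_gt0 s01.
pose x := g (dfwith t n (to_unit s0)).
have Hs (s : R) : 0 < `|s| < eta * r ->
    `|eta *: quotient h u x s - l| <= eta * e / 2.
  move=> /andP[s_neq0 sr].
  pose tau := s / eta.
  have tau_s : s = tau * eta by rewrite /tau divfK ?gt_eqF.
  have taur : `|tau| < r.
    by rewrite /tau normrM normfV (gtr0_norm eta0) ltr_pdivrMr// mulrC.
  move: (taur); rewrite !lt_min => /andP[/andP[tr1 tr2] /andP[ts0 ts1]].
  have tau0 : tau != 0.
    by rewrite -normr_gt0 /tau normrM mulr_gt0// normfV invr_gt0 gtr0_norm.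
  have clamp_s0 : clamp s0 = s0 by apply: clamp_id; rewrite /= in_itv /= !ltW.
  have clamp_tau : clamp (s0 + tau) = s0 + tau.
    apply: clamp_id; rewrite /= in_itv /=.
    by move: ts0 ts1; rewrite !ltr_norml => /andP[? ?] /andP[? ?]; apply/andP; split; lra.
  have := Hr1 tau; rewrite /ball /= sub0r normrN => /(_ tr1 tau0) /=.
  have /Hr2 : ball s0 r2 (s0 + tau).
    by rewrite -ball_normE /= opprD addrA subrr sub0r normrN.
  have -> : tau *: (1 : R) = tau by rewrite /GRing.scale /= mulr1.
  rewrite clamp_tau clamp_s0 (addrC s0) addrK.
  rewrite -/x; set y := g _ => yx lq.
  have -> : eta *: quotient h u x s = tau^-1 *: (h (x + (tau * eta) *: u) - h x).
    rewrite /quotient scalerA {1}tau_s invfM mulrCA mulfV ?gt_eqF// mulr1.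
    by rewrite -tau_s.
  rewrite -(subrK (tau^-1 *: (h y - h x)) (tau^-1 *: _)) -addrA.
  apply: le_trans (ler_normD _ _) _.
  rewrite (_ : eta * e / 2 = eta * e / 4 + eta * e / 4); last by lra.
  apply: lerD; last by rewrite distrC.
  rewrite -scalerBr normrZ opprB addrA subrK normfV.
  rewrite ler_pdivrMl ?normr_gt0//.
  apply: le_trans (hL _ _) _.
  rewrite distrC opprD addrA -scalerA.
  apply: le_trans (ler_wpM2l L0 yx) _.
  rewrite [leRHS]mulrC mulrA ler_wpM2r//.
  by have := ler_wpM2l (ltW eta0) Lde; lra.
exists (eta * r); first exact: mulr_gt0.
(* Each quotient costs [eta * e / 4] for differentiability and [eta * e / 4] for steepness, by
   [4 * L * d <= e]; two quotients give [eta * e]. *)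
move=> s s' /Hs sl /Hs s'l.
rewrite -(ler_pM2l eta0) -{1}(gtr0_norm eta0) -normrZ scalerBr.
rewrite -(subrK l (eta *: quotient h u x s)) -addrA.
apply: le_trans (ler_normD _ _) _.
rewrite (_ : eta * e = eta * e / 2 + eta * e / 2); last by lra.
by apply: lerD => //; rewrite distrC.
Qed.

Lemma Gamma_measurable g : measurable_fun setT (g : borel (cube R) -> borel X).
Proof.
apply: (@measurability _ _ (borel (cube R)) (borel X) setT g (@open X)) => //.
move=> _ [A oA <-]; rewrite setTI.
apply: sub_sigma_algebra.
by have /continuousP := @Gamma_jet_continuous R X g 0; apply.
Qed.

Lemma steep_null h (L : R) u (e d : R) g :
  lipschitz_with h L -> 0 < e -> 0 < d -> 4 * L * d <= e -> 0 <= L -> steep u d g ->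
  mu [set t | ~ oscillates_within h u e (g t)] = 0%E.
Proof.
move=> hL e0 d0 Lde L0 [[n eta] /= eta0 g_steep].
have gr t : `|partial_derive n g t - eta *: u| < eta * d.
  apply: le_lt_trans g_steep.
  by have := Gamma_seminorm_ge g (coord_surface n (eta *: u)) n.+1 t;
    rewrite jet_coord_surface.
apply: (product_lebesgue_null_sections muE (n := n)).
  rewrite -[X in measurable X]setTI; apply: (@Gamma_measurable g measurableT
    [set x | ~ oscillates_within h u e x]).
  by apply: measurable_oscillation; exact: lipschitz_with_continuous hL.
move=> t.
have : lipschitz (fun s : R => h (g (dfwith t n (to_unit s)))).
  apply: (@klipschitzW _ _ _ (L * (`|eta *: u| + eta * d))).
    exact: (globally_properfilter (a := (0, 0))).
  move=> -[s s'] /= _.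
  apply: le_trans (hL _ _) _; rewrite -mulrA ler_wpM2l//.
  exact: Gamma_line_lipschitz.
move=> /RNP; apply: negligibleS => s /= [Hs s01] ds; apply: Hs.
exact: (steep_line_differentiable hL e0 d0 Lde L0 eta0 gr s01 ds).
Qed.

End steep_surfaces.

(** * Gamma-null sets *)

Section residual_sets.
Variable T : topologicalType.

Lemma residualS (A B : set T) : A `<=` B -> residual A -> residual B.
Proof. by move=> AB [C dC CA]; exists C => //; exact: subset_trans AB. Qed.

Lemma open_dense_residual (A : set T) : open A -> dense A -> residual A.
Proof. by move=> oA dA; exists A => //; exists (fun=> A) => //; rewrite bigcap_const. Qed.

Lemma residual_bigcap (A : (set T)^nat) :
  (forall k, residual (A k)) -> residual (\bigcap_k A k).
Proof.
move=> rA.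
have {}rA k : exists F : (set T)^nat,
    (forall i, open (F i) /\ dense (F i)) /\ \bigcap_i F i `<=` A k.
  by have [_ [F FE ->] FA] := rA k; exists F.
have [F HF] := choice rA.
(* The double sequence is enumerated through [pickle]; numbers coding no pair get [setT], which is
   open and dense. *)
pose F' m := if (unpickle m : option (nat * nat)) is Some p
  then F p.1 p.2 else setT.
exists (\bigcap_m F' m).
  exists F' => // m; rewrite /F'; case: unpickle => [p|].
    by have [] := HF p.1.
  by split; [exact: openT|move=> O [x Ox] _; exists x].
move=> x F'x k _; have [_] := HF k; apply => i _.
by have := F'x (pickle (k, i)) I; rewrite /F' pickleK.
Qed.

End residual_sets.

Section Gamma_null_ideal.
Variables (R : realType) (X : completeNormedModType R).
Variable mu : probability (borel (cube R)) R.
Implicit Types (A B : set X).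

Lemma Gamma_nullS A B : A `<=` B -> Gamma_null mu B -> Gamma_null mu A.
Proof. by move=> AB [N nN BN]; exists N => //; exact: subset_trans BN. Qed.

Lemma Gamma_null0 : Gamma_null mu (set0 : set X).
Proof.
exists set0 => //; split; first exact: measurable0.
apply: (@residualS _ setT) => [g _ /=|].
  by rewrite (_ : [set t | _] = set0) ?measure0.
by apply: open_dense_residual; [exact: openT|move=> O [x Ox] _; exists x].
Qed.

Lemma Gamma_null_bigcup_nat (A : (set X)^nat) :
  (forall k, Gamma_null mu (A k)) -> Gamma_null mu (\bigcup_k A k).
Proof.
move=> nA.
have {}nA k : exists N, Borel_Gamma_null mu N /\ A k `<=` N.
  by have [N nN AN] := nA k; exists N.
have [N HN] := choice nA.
have mN k : measurable (N k : set (borel X)) by have [[]] := HN k.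
exists (\bigcup_k N k); last first.
  by move=> x [k _ Akx]; exists k => //; have [_] := HN k; apply.
split; first exact: bigcupT_measurable.
have := residual_bigcap (fun k => proj2 (proj1 (HN k))).
apply: residualS => g' gN /=; pose g : Gamma X := g'.
have mgN k : measurable ([set t | N k (g t)] : set (borel (cube R))).
  by rewrite -[X in measurable X]setTI;
    exact: (@Gamma_measurable _ _ g measurableT (N k)).
rewrite (_ : [set t | _] = \bigcup_k [set t : borel (cube R) | N k (g t)]); last first.
  by apply/seteqP; split => t [k _ Nk]; exists k.
apply: measure_negligible; first exact: bigcupT_measurable.
apply: negligible_bigcup => k; apply/negligibleP => //.
exact: gN.
Qed.

Lemma Gamma_null_bigcup (I : countType) (A : I -> set X) :
  (forall i, Gamma_null mu (A i)) -> Gamma_null mu (\bigcup_i A i).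
Proof.
move=> nA.
pose A' m := if (unpickle m : option I) is Some i then A i else set0.
apply: (@Gamma_nullS _ (\bigcup_m A' m)).
  by move=> x [i _ Aix]; exists (pickle i) => //; rewrite /A' pickleK.
apply: Gamma_null_bigcup_nat => m; rewrite /A'.
by case: unpickle => // ; exact: Gamma_null0.
Qed.

Hypothesis muE : product_lebesgue mu.

Lemma Gamma_null_oscillation (Y : completeNormedModType R) (h : X -> Y) (L : R) u :
  Radon_Nikodym_property Y -> 0 <= L -> lipschitz_with h L ->
  Gamma_null mu [set x | ~ forall e : R, 0 < e -> oscillates_within h u e x].
Proof.
move=> RNP L0 hL.
apply: (@Gamma_nullS _ (\bigcup_k [set x | ~ oscillates_within h u k.+1%:R^-1 x])).
  move=> x /= Hx; apply: contrapT => H; apply: Hx => e e0.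
  near \oo => k.
  have ke : k.+1%:R^-1 < e by near: k; exact: (near_infty_natSinv_lt (PosNum e0)).
  have [d d0 xd] : oscillates_within h u k.+1%:R^-1 x.
    by apply: contrapT => Hk; apply: H; exists k.
  by exists d => // s t sd td; apply: le_trans (xd s t sd td) _; exact: ltW.
apply: Gamma_null_bigcup_nat => k.
have e0 : (0 : R) < k.+1%:R^-1 by rewrite invr_gt0 ltr0n.
set e : R := k.+1%:R^-1 in e0 *.
(* This ensures [4 * L * d <= e], with the added 1 avoiding division by zero when [L = 0]. *)
pose d := e / (4 * (L + 1)).
have L1 : 0 < 4 * (L + 1) by lra.
have d0 : 0 < d by rewrite divr_gt0.
have Lde : 4 * L * d <= e.
  by rewrite /d mulrA ler_pdivrMr//; nra.
exists [set x | ~ oscillates_within h u e x] => //; split.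
  by apply: measurable_oscillation; exact: lipschitz_with_continuous hL.
apply: residualS (open_dense_residual (@open_steep _ _ u d d0) (@dense_steep _ _ u d d0)).
move=> g /= gs; exact: (steep_null muE RNP hL e0 d0 Lde L0 gs).
Unshelve. all: by end_near. Qed.

End Gamma_null_ideal.

(** * From directional to Gateaux derivatives *)

Section directional_derivatives.
Variables (R : realType) (X Y : completeNormedModType R).
Variables (h : X -> Y) (L : R).
Hypotheses (L0 : 0 <= L) (hL : lipschitz_with h L).
Implicit Types (x u v : X) (l : Y).

Definition has_dirderiv u x l : Prop :=
  quotient h u x t @[t --> (0 : R)^'] --> l.

Lemma has_dirderivP u x l : has_dirderiv u x l <->
  forall e : R, 0 < e -> exists2 d : R, 0 < d &
    forall t, 0 < `|t| < d -> `|quotient h u x t - l| <= e.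
Proof.
split=> [/cvgrPdist_le H e e0|H].
  have /nbhs_ballP[d /= d0 Hd] := H e e0.
  exists d => // t /andP[t0 td]; rewrite distrC; apply: Hd.
    by rewrite /ball /= sub0r normrN.
  by rewrite -normr_gt0.
apply/cvgrPdist_le => e e0; have [d d0 Hd] := H e e0.
apply/nbhs_ballP; exists d => // t; rewrite /ball /= sub0r normrN => td t0.
by rewrite distrC Hd// normr_gt0 t0.
Qed.

Lemma quotient_dist u v x t : t != 0 ->
  `|quotient h u x t - quotient h v x t| <= L * `|u - v|.
Proof.
move=> t0; rewrite /quotient -scalerBr opprB addrA subrK normrZ normfV.
rewrite ler_pdivrMl ?normr_gt0//; apply: le_trans (hL _ _) _.
by rewrite opprD addrACA subrr add0r -scalerBr normrZ mulrCA.
Qed.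

(** Difference quotients are [L]-Lipschitz in the direction, uniformly in the scale, so a nearby
    direction in [D] costs [e / 4] at each of the two scales. *)
Lemma oscillates_within_dense (D : set X) x : dense D ->
  (forall u, D u -> forall e : R, 0 < e -> oscillates_within h u e x) ->
  forall u (e : R), 0 < e -> oscillates_within h u e x.
Proof.
move=> dD HD u e e0.
have L1 : 0 < 4 * (L + 1) by have := L0; lra.
have r0 : 0 < e / (4 * (L + 1)) by rewrite divr_gt0.
have [v [uv Dv]] : ball u (e / (4 * (L + 1))) `&` D !=set0.
  by apply: dD; [exists u; exact: ballxx|exact: ball_open].
have {}uv : L * `|u - v| <= e / 4.
  move: uv; rewrite -ball_normE /= => /ltW.
  rewrite ler_pdivlMr// => uv.
  by have := normr_ge0 (u - v); nra.
have e20 : 0 < e / 2 by rewrite divr_gt0.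
have [d d0 vd] := HD v Dv _ e20.
exists d => // s t sd td.
have s0 : s != 0 by rewrite -normr_gt0; have /andP[] := sd.
have t0 : t != 0 by rewrite -normr_gt0; have /andP[] := td.
apply: le_trans (ler_distD (quotient h v x s) _ _) _.
rewrite (_ : e = e / 4 + (e / 2 + e / 4)); last by lra.
apply: lerD; first exact: le_trans (quotient_dist _ _ _ s0) uv.
apply: le_trans (ler_distD (quotient h v x t) _ _) _.
apply: lerD; first exact: vd.
by rewrite distrC; exact: le_trans (quotient_dist _ _ _ t0) uv.
Qed.

Lemma oscillation_has_dirderiv u x :
  (forall e : R, 0 < e -> oscillates_within h u e x) ->
  exists l, has_dirderiv u x l.
Proof.
move=> H.
suff : cvg (quotient h u x t @[t --> (0 : R)^']) by move=> /cvg_ex.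
apply: cauchy_cvg; apply: cauchy_exP => e e0.
have e20 : 0 < e / 2 by rewrite divr_gt0.
have [d d0 Hd] := H _ e20.
exists (quotient h u x (d / 2)); apply/nbhs_ballP; exists d => // t.
move=> td t0.
have {}td : `|t| < d by move: td; rewrite /ball /= sub0r normrN.
rewrite /= -ball_normE /=; apply: (@le_lt_trans _ _ (e / 2)); last by lra.
apply: Hd; last by rewrite normr_gt0 t0.
have d20 : 0 < d / 2 by lra.
by rewrite gtr0_norm// d20 /=; lra.
Qed.

Lemma has_dirderiv_uniq u x l l' :
  has_dirderiv u x l -> has_dirderiv u x l' -> l = l'.
Proof. by move=> /cvg_lim <-// /cvg_lim <-. Qed.

Lemma has_dirderiv_le u v x l l' (c : R) :
  has_dirderiv u x l -> has_dirderiv v x l' -> `|u - v| <= c ->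
  `|l - l'| <= L * c.
Proof.
move=> /has_dirderivP hl /has_dirderivP hl' uvc; apply/ler_addgt0Pr => e e0.
have e20 : 0 < e / 2 by rewrite divr_gt0.
have [d1 d10 H1] := hl _ e20; have [d2 d20 H2] := hl' _ e20.
have d0 : 0 < Num.min d1 d2 by rewrite lt_min d10.
have : Num.min d1 d2 <= d1 by rewrite ge_min lexx.
have : Num.min d1 d2 <= d2 by rewrite ge_min lexx orbT.
move: (Num.min d1 d2) d0 => d d0 dd2 dd1.
have t0 : 0 < d / 2 by rewrite divr_gt0.
have {}H1 := H1 (d / 2); have {}H2 := H2 (d / 2).
rewrite gtr0_norm// t0 /= in H1 H2.
have q1 : `|quotient h u x (d / 2) - l| <= e / 2 by apply: H1; lra.
have q2 : `|quotient h v x (d / 2) - l'| <= e / 2 by apply: H2; lra.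
have q3 : `|quotient h u x (d / 2) - quotient h v x (d / 2)| <= L * c.
  apply: le_trans (quotient_dist _ _ _ _) _; first by rewrite gt_eqF.
  by rewrite ler_wpM2l.
apply: le_trans (ler_distD (quotient h u x (d / 2)) _ _) _.
rewrite distrC; apply: le_trans (lerD q1 (ler_distD (quotient h v x (d / 2)) _ _)) _.
by lra.
Qed.

Lemma has_dirderivZ (c : R) u x l : has_dirderiv u x l ->
  has_dirderiv (c *: u) x (c *: l).
Proof.
move=> /has_dirderivP hl; apply/has_dirderivP => e e0.
have [->|c0] := eqVneq c 0.
  exists 1 => // t _.
  by rewrite /quotient !scale0r scaler0 addr0 subrr scaler0 subr0 normr0 ltW.
have cp : 0 < `|c| by rewrite normr_gt0.
have [d d0 Hd] := hl (e / `|c|) (divr_gt0 e0 cp).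
exists (d / `|c|); first exact: divr_gt0.
move=> t /andP[t0 td].
have -> : quotient h (c *: u) x t = c *: quotient h u x (t * c).
  by rewrite /quotient !scalerA invfM mulrCA mulfV// mulr1.
rewrite -scalerBr normrZ -ler_pdivlMl// [leRHS]mulrC; apply: Hd.
by rewrite normrM mulr_gt0//= -ltr_pdivlMr.
Qed.

(** The map [d] is [L]-Lipschitz, so additivity passes to the closure. [D] need not be stable under
    sums, as [hd] covers all directions. *)
Lemma additive_dirderiv_dense (D : set X) x (d : X -> Y) : dense D ->
  (forall u, has_dirderiv u x (d u)) ->
  (forall u v, D u -> D v -> d (u + v) = d u + d v) ->
  forall u v, d (u + v) = d u + d v.
Proof.
move=> dD hd add u v; apply/eqP; rewrite -subr_eq0 -normr_le0.
apply/ler_addgt0Pr => e e0; rewrite add0r.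
have L1 : 0 < 4 * (L + 1) by have := L0; lra.
have r0 : 0 < e / (4 * (L + 1)) by rewrite divr_gt0.
set r := e / (4 * (L + 1)) in r0.
have approx w : exists2 w', D w' & `|w - w'| <= r.
  have [w' [ww' Dw']] : ball w r `&` D !=set0.
    by apply: dD; [exists w; exact: ballxx|exact: ball_open].
  by exists w' => //; move: ww'; rewrite -ball_normE /= => /ltW.
have [u' Du' uu'] := approx u.
have [v' Dv' vv'] := approx v.
have H1 := has_dirderiv_le (hd u) (hd u') uu'.
have H2 := has_dirderiv_le (hd v) (hd v') vv'.
have uv : `|u + v - (u' + v')| <= 2 * r.
  by rewrite opprD addrACA; apply: le_trans (ler_normD _ _) _; lra.
have H3 := has_dirderiv_le (hd (u + v)) (hd (u' + v')) uv.
rewrite (add _ _ Du' Dv') in H3.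
have -> : d (u + v) - (d u + d v) =
    (d (u + v) - (d u' + d v')) - ((d u - d u') + (d v - d v')).
  by rewrite [X in _ = _ - X]addrACA -opprD [in RHS]opprB addrA subrK.
apply: le_trans (ler_normB _ _) _.
have := ler_normD (d u - d u') (d v - d v').
have : 4 * (L * r) <= e.
  by rewrite /r !mulrA ler_pdivrMr//; have := L0; nra.
by lra.
Qed.

(** Existence spreads from [D] to all directions by the Lipschitz bound, which also gives
    continuity; homogeneity is automatic, so only additivity remains as a hypothesis. *)
Lemma Gateaux_of_dirderiv (D : set X) x : dense D ->
  (forall u, D u -> forall e : R, 0 < e -> oscillates_within h u e x) ->
  (forall u v l l' l'', D u -> D v -> has_dirderiv u x l -> has_dirderiv v x l' ->
    has_dirderiv (u + v) x l'' -> l'' = l + l') ->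
  Gateaux_differentiable h x.
Proof.
move=> dD osc add.
have /choice[d hd] : forall u, exists l, has_dirderiv u x l.
  by move=> u; apply: oscillation_has_dirderiv;
    exact: (oscillates_within_dense dD osc).
have dadd := additive_dirderiv_dense dD hd
  (fun u v Du Dv => add _ _ _ _ _ Du Dv (hd u) (hd v) (hd (u + v))).
have dlin : linear d.
  move=> c u v; rewrite dadd; congr (_ + _).
  by apply: (has_dirderiv_uniq (hd (c *: u))); exact: has_dirderivZ.
pose d' : {linear X -> Y} := HB.pack d (GRing.isLinear.Build R X Y *:%R d dlin).
exists d'; split; last exact: hd.
apply: (@lipschitz_with_continuous _ _ _ _ L) => u v.
exact: has_dirderiv_le (hd u) (hd v) (lexx _).
Qed.

End directional_derivatives.

(** * The distance to a set *)

Section distance_to_a_set.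
Variables (R : realType) (X : normedModType R).
Implicit Types (A : set X) (x y a : X).

Definition infdist A x : R := inf [set `|x - a| | a in A].

Lemma infdist_le A x a : A a -> infdist A x <= `|x - a|.
Proof.
by move=> Aa; apply: ge_inf; [exists 0 => _ [b _ <-]|exists a].
Qed.

Lemma le_infdist A x (r : R) : A !=set0 ->
  (forall a, A a -> r <= `|x - a|) -> r <= infdist A x.
Proof.
move=> [a Aa] rA; apply: lb_le_inf; first by exists `|x - a|, a.
by move=> _ [b Ab <-]; exact: rA.
Qed.

Lemma infdist_ge0 A x : A !=set0 -> 0 <= infdist A x.
Proof. by move=> A0; apply: le_infdist. Qed.

Lemma infdist_mem A x : A x -> infdist A x = 0.
Proof.
move=> Ax; apply/eqP; rewrite eq_le infdist_ge0; last by exists x.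
by rewrite andbT; have := infdist_le x Ax; rewrite subrr normr0.
Qed.

(* This includes [A = set0], for which [infdist A] is [0] since [inf set0 = 0]. *)
Lemma infdist_lip A x y : `|infdist A x - infdist A y| <= `|x - y|.
Proof.
have [->|/set0P A0] := eqVneq A set0.
  by rewrite /infdist !image_set0 subrr normr0.
have half z w : infdist A z - infdist A w <= `|z - w|.
  rewrite lerBlDr addrC -lerBlDr; apply: le_infdist => // a Aa.
  rewrite lerBlDr; apply: le_trans (infdist_le z Aa) _.
  by rewrite [leRHS]addrC; exact: ler_distD.
by rewrite ler_norml half andbT lerNl opprB distrC half.
Qed.

Lemma infdist_lt A x (r : R) : A !=set0 -> infdist A x < r ->
  exists2 a, A a & `|x - a| < r.
Proof.
move=> A0 Ar; apply: contrapT => H; move: Ar; apply/negP; rewrite -leNgt.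
apply: le_infdist => // a Aa; rewrite leNgt; apply/negP => ar.
by apply: H; exists a.
Qed.

End distance_to_a_set.

(** * Additivity of directional derivatives *)

Section additivity.
Variables (R : realType) (X Y : completeNormedModType R).
Implicit Types (u v x : X) (y z : Y).

(** The distance is nonnegative and vanishes at [x], so the quotients at [t] and [- t] point in
    opposite directions. Their difference contains the sum of the two distances, and small
    oscillation forces both to be small relative to [|t|]. *)
Lemma oscillation_infdist (A : set X) (y0 : Y) u x : y0 != 0 -> A x ->
  (forall e : R, 0 < e ->
    oscillates_within (fun w => infdist A w *: y0) u e x) ->
  forall e : R, 0 < e -> exists2 d : R, 0 < d & forall t : R, 0 < `|t| < d ->
    exists2 x', A x' & `|x + t *: u - x'| <= e * `|t|.
Proof.
move=> y00 Ax osc e e0.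
have y0p : 0 < `|y0| by rewrite normr_gt0.
have A0 : A !=set0 by exists x.
(* Half of [e] leaves room for a strict inequality, needed to pick a point of [A] nearly realizing
   the infimum. *)
have e'0 : 0 < e / 2 * `|y0| by rewrite mulr_gt0// divr_gt0.
have [d d0 Hd] := osc _ e'0.
exists d => // t td; have t0 : 0 < `|t| by have /andP[] := td.
have := Hd t (- t) td; rewrite normrN => /(_ td).
rewrite /quotient (infdist_mem Ax) scale0r !subr0.
rewrite invrN (scaleNr t^-1) opprK -scalerDr -scalerDl !normrZ normfV.
rewrite ler_pdivrMl// mulrA ler_pM2r//.
have a0 := infdist_ge0 (x + t *: u) A0.
have b0 := infdist_ge0 (x + - t *: u) A0.
rewrite ger0_norm ?addr_ge0// => ab.
have te : 0 < `|t| * e by rewrite mulr_gt0.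
have [x' Ax' xx'] : exists2 x', A x' & `|x + t *: u - x'| < e * `|t|.
  by apply: infdist_lt => //; lra.
by exists x' => //; exact: ltW.
Qed.

Variables (h : X -> Y) (L : R).
Hypotheses (L0 : 0 <= L) (hL : lipschitz_with h L).

Definition linear_along v z (r e : R) : set X :=
  [set x | forall t : R, 0 < `|t| < r -> `|quotient h v x t - z| <= e].

Lemma linear_along_dist v z (r e : R) x l : 0 < r ->
  linear_along v z r e x -> has_dirderiv h v x l -> `|l - z| <= e.
Proof.
move=> r0 xA /has_dirderivP hl; apply/ler_addgt0Pr => e' e'0.
have [d d0 Hd] := hl _ e'0.
have : Num.min d r <= d by rewrite ge_min lexx.
have : Num.min d r <= r by rewrite ge_min lexx orbT.
have : 0 < Num.min d r by rewrite lt_min d0.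
move: (Num.min d r) => s s0 sr sd.
have t0 : 0 < s / 2 by rewrite divr_gt0.
have := Hd (s / 2); have := xA (s / 2); rewrite gtr0_norm// t0 /=.
have sr' : s / 2 < r by lra.
have sd' : s / 2 < d by lra.
move=> /(_ sr') qz /(_ sd') ql.
apply: le_trans (ler_distD (quotient h v x (s / 2)) _ _) _.
by rewrite distrC addrC lerD.
Qed.

Lemma dirderivD_dist u v z (r e : R) x l l'' : 0 < r ->
  (forall e' : R, 0 < e' -> exists2 d : R, 0 < d & forall t : R, 0 < `|t| < d ->
    exists2 x', linear_along v z r e x' & `|x + t *: u - x'| <= e' * `|t|) ->
  has_dirderiv h u x l -> has_dirderiv h (u + v) x l'' -> `|l'' - l - z| <= e.
Proof.
move=> r0 por /has_dirderivP hu /has_dirderivP huv.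
apply/ler_addgt0Pr => e1 e10.
have L1 : 0 < 2 * (L + 1) by have := L0; lra.
(* The errors are [L * e'] for each of two displacements from [x + s *: u] to [x'], and [e'] for
   each of two quotients: in total [e1]. *)
have e'0 : 0 < e1 / (2 * (L + 1)) by rewrite divr_gt0.
have e'E : e1 / (2 * (L + 1)) * (2 * (L + 1)) = e1 by rewrite divfK// gt_eqF.
move: (e1 / (2 * (L + 1))) e'0 e'E => e' e'0 e'E.
have [d1 d10 H1] := por _ e'0.
have [d2 d20 H2] := hu _ e'0.
have [d3 d30 H3] := huv _ e'0.
have [s [s0 [sr sd1] [sd2 sd3]]] : exists s : R,
    [/\ 0 < s, s < r /\ s < d1 & s < d2 /\ s < d3].
  exists (Num.min (Num.min r d1) (Num.min d2 d3) / 2).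
  have : 0 < Num.min (Num.min r d1) (Num.min d2 d3).
    by rewrite !lt_min r0 d10 d20 d30.
  have : Num.min (Num.min r d1) (Num.min d2 d3) <= r by rewrite !ge_min lexx.
  have : Num.min (Num.min r d1) (Num.min d2 d3) <= d1.
    by rewrite !ge_min lexx !orbT.
  have : Num.min (Num.min r d1) (Num.min d2 d3) <= d2.
    by rewrite !ge_min lexx !orbT.
  have : Num.min (Num.min r d1) (Num.min d2 d3) <= d3.
    by rewrite !ge_min lexx !orbT.
  by move: (Num.min _ _) => m ? ? ? ? ?; split; [|split|split]; lra.
have sn : `|s| = s by rewrite gtr0_norm.
have s_neq0 : s != 0 by rewrite gt_eqF.
have [x' Ax' xx'] : exists2 x', linear_along v z r e x' & `|x + s *: u - x'| <= e' * `|s|.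
  by apply: H1; rewrite sn s0.
have {}H2 : `|quotient h u x s - l| <= e' by apply: H2; rewrite sn s0.
have {}H3 : `|quotient h (u + v) x s - l''| <= e' by apply: H3; rewrite sn s0.
have H4 : `|quotient h v x' s - z| <= e by apply: Ax'; rewrite sn s0.
have shift w w' : `|w - w'| <= e' * s -> `|s^-1 *: (h w - h w')| <= L * e'.
  move=> ww'; rewrite normrZ normfV sn ler_pdivrMl//.
  apply: le_trans (hL _ _) _; rewrite [leRHS]mulrC -mulrA.
  by rewrite ler_wpM2l.
rewrite sn in xx'.
have S1 := shift _ _ xx'.
have S2 : `|s^-1 *: (h (x + s *: (u + v)) - h (x' + s *: v))| <= L * e'.
  by apply: shift; rewrite scalerDr addrA opprD addrACA subrr addr0.
(* The increment of [h] by [s *: v] from [x + s *: u] is replaced by the one from [x'], which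
   belongs to the set where it is controlled by [z]. *)
have -> : l'' - l - z =
   (s^-1 *: (h (x + s *: (u + v)) - h (x' + s *: v))
    - s^-1 *: (h (x + s *: u) - h x'))
   + (quotient h v x' s - z)
   + ((quotient h u x s - l) - (quotient h (u + v) x s - l'')).
  rewrite /quotient; move: (h (x + s *: (u + v))) (h (x' + s *: v))
    (h (x + s *: u)) (h x') (h x) => a b c d f.
  rewrite -scalerBr !scalerBr.
  move: (s^-1 *: a) (s^-1 *: b) (s^-1 *: c) (s^-1 *: d) (s^-1 *: f)
    => {}a {}b {}c {}d {}f.
  have tel (p q r' : Y) : (p - q) + (q - r') = p - r' by rewrite addrA subrK.
  have -> : a - b - (c - d) + (b - d - z) = a - c - z.
    by rewrite opprB [LHS]addrA; congr (_ - z); rewrite addrAC !tel.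
  have tel' (p q w : Y) : (p - q) - (w - q) = p - w by rewrite opprB tel.
  have -> : c - f - l - (a - f - l'') = (c - l) + (l'' - a).
    by rewrite (addrAC c) (addrAC a) tel' (opprB a).
  by rewrite [RHS]addrC [RHS]addrA; congr (_ - z); rewrite -addrA tel [RHS]addrC tel.
apply: le_trans (ler_normD _ _) _.
apply: le_trans (lerD (ler_normD _ _) (ler_normB _ _)) _.
apply: le_trans (lerD (lerD (ler_normB _ _) (lexx _)) (lexx _)) _.
by rewrite -e'E; lra.
Qed.

(** As [Y] may be non-separable, the values [z] are taken from a countable list of quotients of [h]
    at points of the dense sequence; by continuity in the base point these approximate [l]. *)
Lemma linear_along_exists (p : nat -> X) v x l (e : R) : dense (range p) ->
  has_dirderiv h v x l -> 0 < e ->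
  exists ijk : nat * nat * nat,
    linear_along v (quotient h v (p ijk.1.1) ijk.1.2.+1%:R^-1) ijk.2.+1%:R^-1 e x.
Proof.
move=> dp /has_dirderivP hl e0.
have e20 : 0 < e / 2 by rewrite divr_gt0.
have e40 : 0 < e / 4 by rewrite divr_gt0.
have [d d0 Hd] := hl _ e20; have [d' d'0 Hd'] := hl _ e40.
have inv_small (r : R) : 0 < r -> exists k : nat, k.+1%:R^-1 < r.
  move=> r0; near \oo => k; exists k.
  by near: k; exact: (near_infty_natSinv_lt (PosNum r0)).
have [k kd] := inv_small _ d0.
have [j jd'] := inv_small _ d'0.
have j0 : 0 < j.+1%:R^-1 :> R by rewrite invr_gt0 ltr0n.
have := continuous_quotient (u := v) (t := j.+1%:R^-1) (lipschitz_with_continuous hL).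
move=> /(_ x) /cvgrPdist_le /(_ _ e40).
rewrite -nbhs_nearE nbhsE => -[U [oU Ux] HU].
have [w [Upi [i _ piw]]] : U `&` range p !=set0 by apply: dp => //; exists x.
rewrite -piw in Upi.
exists (i, j, k) => t /andP[t0 tk] /=.
apply: le_trans (ler_distD l _ _) _.
rewrite (_ : e = e / 2 + (e / 4 + e / 4)); last by lra.
apply: lerD; first by apply: Hd; rewrite t0 (lt_trans tk).
apply: le_trans (ler_distD (quotient h v x j.+1%:R^-1) _ _) _.
apply: lerD; last exact: HU.
by rewrite distrC; apply: Hd'; rewrite gtr0_norm// j0.
Unshelve. all: by end_near. Qed.

End additivity.

(** * Lipschitz maps *)

Section Lipschitz_maps.
Variables (R : realType) (X Y : completeNormedModType R).
Variable mu : probability (borel (cube R)) R.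
Hypothesis muE : product_lebesgue mu.
Hypothesis RNP : Radon_Nikodym_property Y.

Lemma separable_dense_sequence : separable_space X ->
  exists p : nat -> X, dense (range p).
Proof.
move=> [D cD dD].
have [g Dg] : exists g : nat -> X, set_surj [set: nat] D g.
  exact: (pcard_surjP cD).
exists g; move=> U U0 oU; have [x [Ux Dx]] := dD U U0 oU.
by exists x; split => //; exact: Dg.
Qed.

Lemma trivial_Gateaux (h : X -> Y) x : (forall y : Y, y = 0) ->
  Gateaux_differentiable h x.
Proof.
move=> Y0.
pose d : {linear X -> Y} := [the {linear X -> Y} of \0].
exists d; split; first by move=> z; exact: cvg_cst.
by move=> u; rewrite (Y0 (d u)); apply: cvg_near_cst; near=> t; exact: Y0.
Unshelve. all: by end_near. Qed.

Lemma Gamma_null_not_Gateaux_globally (h : X -> Y) (L : R) :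
  separable_space X -> 0 <= L -> lipschitz_with h L ->
  Gamma_null mu [set x | ~ Gateaux_differentiable h x].
Proof.
move=> /separable_dense_sequence[p dp] L0 hL.
(* A nonzero vector turns real distance functions into [Y]-valued maps; if there is none, every map
   is trivially differentiable. *)
have [[y0 y00]|Y0] := pselect (exists y0 : Y, y0 != 0); last first.
  apply: (@Gamma_nullS _ _ _ _ set0); last exact: Gamma_null0.
  move=> x; apply; apply: trivial_Gateaux => y.
  by apply: contrapT => /eqP y0; apply: Y0; exists y.
pose A b (ijk : nat * nat * nat) m := linear_along h (p b)
  (quotient h (p b) (p ijk.1.1) ijk.1.2.+1%:R^-1) ijk.2.+1%:R^-1 m.+1%:R^-1.
(* Countably many requirements: [inl] for [h] itself along the dense directions, [inr] for the
   distances to all sets [A] along the same directions. *)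
pose good (i : nat + nat * nat * (nat * nat * nat) * nat) : X -> Prop :=
  match i with
  | inl a => fun x => forall e : R, 0 < e -> oscillates_within h (p a) e x
  | inr (a, b, ijk, m) => fun x => forall e : R, 0 < e ->
      oscillates_within (fun w => infdist (A b ijk m) w *: y0) (p a) e x
  end.
apply: (@Gamma_nullS _ _ _ _ (\bigcup_i [set x | ~ good i x])); last first.
  apply: Gamma_null_bigcup => -[a|[[[a b] ijk] m]].
    exact: (Gamma_null_oscillation muE (p a) RNP L0 hL).
  apply: (Gamma_null_oscillation muE (p a) RNP (normr_ge0 y0)) => x y.
  by rewrite -scalerBl normrZ mulrC ler_wpM2l// infdist_lip.
move=> x Hx; apply: contrapT => Ngood; apply: Hx.
have {}Ngood i : good i x by apply: contrapT => Hi; apply: Ngood; exists i.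
apply: (Gateaux_of_dirderiv L0 hL dp) => [_ [a _ <-]|].
  exact: (Ngood (inl a)).
move=> _ _ l l' l'' [a _ <-] [b _ <-] hl hl' hl''.
apply/eqP; rewrite -subr_eq0 -normr_le0; apply/ler_addgt0Pr => e e0.
rewrite add0r.
have e20 : 0 < e / 2 by rewrite divr_gt0.
near \oo => m.
have me : m.+1%:R^-1 < e / 2.
  by near: m; exact: (near_infty_natSinv_lt (PosNum e20)).
have m0 : 0 < m.+1%:R^-1 :> R by rewrite invr_gt0 ltr0n.
have [ijk Ax] := linear_along_exists hL dp hl' m0.
have k0 : 0 < ijk.2.+1%:R^-1 :> R by rewrite invr_gt0 ltr0n.
have por := oscillation_infdist y00 Ax (Ngood (inr (a, b, ijk, m))).
have D1 := dirderivD_dist L0 hL k0 por hl hl''.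
have D2 := linear_along_dist k0 Ax hl'.
set z := quotient _ _ _ _ in D1 D2.
have -> : l'' - (l + l') = (l'' - l - z) - (l' - z).
  by rewrite opprB addrA subrK opprD addrA.
apply: le_trans (le_trans (ler_normB _ _) (lerD D1 D2)) _.
by rewrite [leRHS]splitr; apply: lerD; exact: ltW.
Unshelve. all: by end_near. Qed.

Lemma Gateaux_local (f h : X -> Y) x : (\forall y \near x, f y = h y) ->
  Gateaux_differentiable h x -> Gateaux_differentiable f x.
Proof.
move=> fh [d [cd hd]]; exists d; split => // u.
apply: cvg_trans (hd u); apply: near_eq_cvg.
have fhx : f x = h x by exact: nbhs_singleton fh.
have xu : x + t *: u @[t --> (0 : R)^'] --> x.
  rewrite -[X in _ --> X]addr0 -(scale0r u).
  apply: cvgD; first exact: cvg_cst.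
  apply: cvgZ; last exact: cvg_cst.
  exact: cvg_within.
have := xu _ fh; rewrite /= => fhu.
near=> t; rewrite fhx; congr (_ *: (_ - _)); apply/esym.
by near: t; exact: fhu.
Unshelve. all: by end_near. Qed.

(** The factor is 1 within [r] of [c], 0 beyond [2 * r], and has slope at most [r^-1]. The constant
    is that of [f] plus this slope times the bound [|f c| + M * (2 * r)] for [f] on the larger
    ball. *)
Lemma clamp_cutoff_lipschitz (f : X -> Y) (M r : R) (c : X) : 0 <= M -> 0 < r ->
  (forall x y, `|x - c| <= 2 * r -> `|y - c| <= 2 * r ->
    `|f x - f y| <= M * `|x - y|) ->
  lipschitz_with (fun x => clamp (2 - r^-1 * `|x - c|) *: f x)
    (M + r^-1 * (`|f c| + M * (2 * r))).
Proof.
move=> M0 r0 fM.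
pose phi x := clamp (2 - r^-1 * `|x - c|).
pose K := `|f c| + M * (2 * r).
have K0 : 0 <= K by rewrite addr_ge0// !mulr_ge0// ltW.
have rV0 : 0 <= r^-1 by rewrite invr_ge0 ltW.
have phi_lip x y : `|phi x - phi y| <= r^-1 * `|x - y|.
  apply: le_trans (clamp_lip _ _) _.
  rewrite opprD addrACA subrr add0r opprK addrC -mulrBr normrM ger0_norm//.
  rewrite ler_wpM2l// distrC; apply: le_trans (ler_dist_dist _ _) _.
  by rewrite opprB addrA subrK.
have phi1 x : 0 <= phi x <= 1.
  exact: (val_unit_itv (to_unit _)).
have phi0 x : ~ `|x - c| <= 2 * r -> phi x = 0.
  move=> /negP; rewrite -ltNge => xc; rewrite /phi /clamp.
  have : 2 < r^-1 * `|x - c| by rewrite ltr_pdivlMl// mulrC.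
  move: (r^-1 * _) => q q2; apply/max_idPl; rewrite ge_min.
  by apply/orP; right; lra.
have fK x : `|x - c| <= 2 * r -> `|f x| <= K.
  move=> xc; rewrite -(subrK (f c) (f x)) addrC.
  apply: le_trans (ler_normD _ _) _; rewrite lerD2l.
  apply: le_trans (fM _ _ xc _) _; last by rewrite ler_wpM2l.
  by rewrite subrr normr0 mulr_ge0// ltW.
(* Only [y] has to lie in the larger ball: if [x] does not, its factor is 0 and the term with
   [f x - f y] disappears. *)
have main x y : `|y - c| <= 2 * r ->
    `|phi x *: f x - phi y *: f y| <= (M + r^-1 * K) * `|x - y|.
  move=> yc; have [x01 x11] := andP (phi1 x).
  have -> : phi x *: f x - phi y *: f y =
      phi x *: (f x - f y) + (phi x - phi y) *: f y.
    by rewrite scalerBr scalerBl addrA subrK.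
  apply: le_trans (ler_normD _ _) _; rewrite mulrDl; apply: lerD.
    have [xc|xc] := pselect (`|x - c| <= 2 * r); last first.
      by rewrite phi0// scale0r normr0 mulr_ge0.
    rewrite normrZ ger0_norm//; apply: le_trans (_ : 1 * `|f x - f y| <= _).
      by rewrite ler_wpM2r.
    by rewrite mul1r; exact: fM.
  rewrite normrZ mulrAC; apply: ler_pM => //; exact: fK.
move=> x y; rewrite -/(phi x) -/(phi y) -/K.
have [yc|yc] := pselect (`|y - c| <= 2 * r); first exact: main.
have [xc|xc] := pselect (`|x - c| <= 2 * r).
  by rewrite distrC (distrC x); exact: main.
rewrite !phi0// !scale0r subrr normr0 !mulr_ge0// addr_ge0//.
by rewrite mulr_ge0.
Qed.

End Lipschitz_maps.

Theorem theorem2p5 (R : realType) (mu : probability (borel (cube R)) R)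
    (X Y : completeNormedModType R) (G : set X) (f : X -> Y) :
  product_lebesgue mu ->
  separable_space X ->
  Radon_Nikodym_property Y ->
  open G ->
  [lipschitz f x | x in G] ->
  Gamma_null mu [set x | G x /\ ~ Gateaux_differentiable f x].
Proof.
move=> muE sX RNP oG lipf.
have [M M0 fM] : exists2 M : R, 0 < M &
    forall x y, G x -> G y -> `|f x - f y| <= M * `|x - y|.
  have [M M0 HM] := pinfty_ex_gt0 lipf.
  by exists M => // x y Gx Gy; exact: (HM (x, y)).
have [p dp] := separable_dense_sequence sX.
(* Balls with centres in the dense sequence and radii [k.+1%:R^-1], kept when the doubled ball lies
   in [G]; the cut-off removes the arbitrary values of [f] outside [G]. *)
pose inside (i : nat * nat) :=
  forall x, `|x - p i.1| <= 2 * i.2.+1%:R^-1 -> G x.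
pose h (i : nat * nat) x := clamp (2 - i.2.+1%:R^-1^-1 * `|x - p i.1|) *: f x.
pose bad i := [set x | inside i /\ ~ Gateaux_differentiable (h i) x].
have r0 (k : nat) : (0 : R) < k.+1%:R^-1 by rewrite invr_gt0 ltr0n.
apply: (@Gamma_nullS _ _ _ _ (\bigcup_i bad i)); last first.
  apply: Gamma_null_bigcup => i.
  have [ini|nini] := pselect (inside i); last first.
    by apply: (@Gamma_nullS _ _ _ _ set0); [move=> x []|exact: Gamma_null0].
  apply: (@Gamma_nullS _ _ _ _ [set x | ~ Gateaux_differentiable (h i) x]).
    by move=> x [].
  apply: (Gamma_null_not_Gateaux_globally muE RNP sX); last first.
    apply: (clamp_cutoff_lipschitz (ltW M0) (r0 i.2)) => x y xc yc.
    by apply: fM; exact: ini.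
  by rewrite addr_ge0 ?mulr_ge0 ?addr_ge0 ?mulr_ge0// ltW.
move=> x [Gx ndx].
have /nbhs_ballP[e /= e0 eG] : nbhs x G by apply: open_nbhs_nbhs.
(* Points of the doubled ball are within three radii of [x]: two to the centre and one from the
   centre to [x]. *)
have e30 : 0 < e / 3 by rewrite divr_gt0.
near \oo => k.
have ke : k.+1%:R^-1 < e / 3.
  by near: k; exact: (near_infty_natSinv_lt (PosNum e30)).
have [w [xi [i _ piw]]] : ball x k.+1%:R^-1 `&` range p !=set0.
  by apply: dp; [exists x; exact: ballxx|exact: ball_open].
rewrite -piw -ball_normE /= in xi.
exists (i, k) => //; split.
  move=> y /= yp; apply: eG; rewrite -ball_normE /=.
  apply: le_lt_trans (ler_distD (p i) _ _) _.
  rewrite (distrC (p i)); move: ke xi yp.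
  by move: (k.+1%:R^-1) => q ? ? ?; lra.
apply: contra_not ndx; apply: Gateaux_local.
have : nbhs x (ball (p i) k.+1%:R^-1).
  by apply: open_nbhs_nbhs; split; [exact: ball_open|rewrite -ball_normE /= distrC].
apply: filterS => y; rewrite -ball_normE /= => /ltW yp.
rewrite /h /= invrK.
have -> : clamp (2 - k.+1%:R * `|y - p i|) = 1; last by rewrite scale1r.
have : k.+1%:R * `|y - p i| <= 1.
  by rewrite -ler_pdivlMl ?ltr0n// mulr1 distrC.
move: (k.+1%:R * _) => q q1.
rewrite /clamp min_l; last by lra.
by rewrite max_r.
Unshelve. all: by end_near. Qed.
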